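(* Let $s\ge 1$, let $\zeta_0,\dots,\zeta_{s-1}$ be distinct points of the unit circle $\mathbb{T}$, let $c_0,\dots,c_{s-1}>0$, and let $\mu=c_0\delta_{\zeta_0}+\cdots+c_{s-1}\delta_{\zeta_{s-1}}$. Equip $\mathcal{D}_\mu$ with the norm $\|f\|_{\mathcal{D}_\mu}^2=\sum_{k=0}^{s-1}|f(\zeta_k)|^2+\|Qf\|_{H^2}^2$, and let $\mathcal{P}_n$ be the subspace of polynomials of degree at most $n$. Let $f(z)=\sum_{j=0}^\infty\hat f(j)z^j\in\mathcal{D}_\mu$. Then, for every $n\ge s$, $$\operatorname{dist}_{\mathcal{D}_\mu}(f,\mathcal{P}_n)=\left\{\sum_{j=n+1}^{\infty}\left|\sum_{k=j}^{\infty}\hat f(k)\,S_{k-j}(\zeta_0,\dots,\zeta_{s-1})\right|^2\right\}^{1/2}.$$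
   Context: $\mathbb{D}$ is the open unit disk, $\mathbb{T}$ its boundary, $H^2$ the Hardy space of $\mathbb{D}$ with its usual norm ($\|g\|_{H^2}^2=\sum_{j\ge 0}|\hat g(j)|^2$). For a finite positive measure $\mu$ on $\mathbb{T}$, let $P\mu(z)=\int_{\mathbb{T}}\frac{1-|z|^2}{|z-\zeta|^2}\,d\mu(\zeta)$. The space $\mathcal{D}_\mu$ consists of the analytic functions $f$ on $\mathbb{D}$ with $\frac1\pi\int_{\mathbb{D}}|f'(z)|^2P\mu(z)\,dA(z)<\infty$, where $dA=dx\,dy$. For $\mu=\sum_{k=0}^{s-1}c_k\delta_{\zeta_k}$ with $c_k>0$ and distinct $\zeta_k\in\mathbb{T}$, it is known that an analytic function $f$ on $\mathbb{D}$ lies in $\mathcal{D}_\mu$ if and only if it can be written as $f(z)=a_0+a_1z+\cdots+a_{s-1}z^{s-1}+q(z)g(z)$ with $a_0,\dots,a_{s-1}\in\mathbb{C}$, $g\in H^2$ and $q(z)=(z-\zeta_0)\cdots(z-\zeta_{s-1})$; this representation is unique. One sets $Qf:=g$ and $f(\zeta_k):=\lim_{r\to1^-}f(r\zeta_k)$, which exists and equals $a_0+a_1\zeta_k+\cdots+a_{s-1}\zeta_k^{s-1}$. The operator $Q$ is also $Q_{\zeta_0}\cdots Q_{\zeta_{s-1}}$, where $(Q_\zeta f)(z)=\frac{f(z)-f(\zeta)}{z-\zeta}$. $S_k$ is the complete homogeneous symmetric polynomial in $s$ variables: $S_0=1$ and, for $k\ge1$, $S_k(z_1,\dots,z_s)=\sum_{1\le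 i_1\le\cdots\le i_k\le s}z_{i_1}\cdots z_{i_k}$. $\operatorname{dist}_{\mathcal{D}_\mu}(f,M)=\inf_{h\in M}\|f-h\|_{\mathcal{D}_\mu}$. Infinite series of complex numbers are understood as limits of their partial sums; convergence of the inner series is part of the assertion. *)

(* Defs.v *)
From HB Require Import structures.
From mathcomp Require Import all_boot all_order all_algebra.
From mathcomp Require Import all_classical all_reals all_analysis.
From mathcomp Require Import complex.

Set Implicit Arguments.
Unset Strict Implicit.
Unset Printing Implicit Defensive.

Import Order.TTheory GRing.Theory Num.Theory.
Import numFieldNormedType.Exports.
Import Normc.

Local Open Scope classical_set_scope.
Local Open Scope complex_scope.
Local Open Scope ring_scope.

(* R[i] gets the topology and norm that any numFieldType carries, so that
   [derivable f z 1] is complex differentiability at z.  Moduli are taken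
   with [normc : R[i] -> R], because `|z| is itself an element of R[i]. *)
HB.instance Definition _ (R : realType) := NormedModule.copy R[i] R[i]^o.

Section disk.
Variable R : realType.
Implicit Types (z : R[i]) (f g : R[i] -> R[i]) (a : nat -> R[i]).

Definition disk : set R[i] := [set z | normc z < 1].
Definition circle : set R[i] := [set z | normc z = 1].

Definition holomorphic_on_disk f := forall z, disk z -> derivable f z 1.

Definition taylor_on_disk f a :=
  forall z, disk z -> series (fun j => a j * z ^+ j) @ \oo --> f z.

(* The expansion is unique when it exists; f need not be analytic off the
   disk. *)
Definition taylor_coef f : nat -> R[i] :=
  xget (fun=> 0) [set a | taylor_on_disk f a].

Definition H2 : set (R[i] -> R[i]) :=
  [set g | exists2 a, taylor_on_disk g a
                    & cvgn (series (fun j => normc (a j) ^+ 2))].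

Definition H2norm g : R :=
  Num.sqrt (limn (series (fun j => normc (taylor_coef g j) ^+ 2))).

Definition radial_lim f (zeta : R[i]) : R[i] :=
  lim (f (r%:C * zeta) @[r --> (1 : R)^'-]).

End disk.
Arguments disk {R}.
Arguments circle {R}.
Arguments H2 {R}.

Section Dspace.
Variable R : realType.

Definition borelC := g_sigma_algebraType (@open R[i]).

Local Open Scope ereal_scope.

(* A measure on the circle is represented by a Borel measure on R[i], of which
   only the restriction to the circle is used. *)
Definition poisson (mu : {measure set borelC -> \bar R}) (z : R[i]) : \bar R :=
  \int[mu]_(zeta in (circle : set borelC))
    ((1 - normc z ^+ 2) / normc (z - zeta) ^+ 2)%R%:E.

Definition Dspace (mu : {measure set borelC -> \bar R}) : set (R[i] -> R[i]) :=
  [set f | holomorphic_on_disk f /\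
    (pi^-1)%R%:E *
    \int[@lebesgue_measure R \x @lebesgue_measure R]_
        (p in [set p : R * R | disk (p.1 +i* p.2)%C])
      ((normc ((derive1 f) (p.1 +i* p.2)%C) ^+ 2)%R%:E
        * poisson mu (p.1 +i* p.2)%C) < +oo].

End Dspace.

Section atomic_measure.
Variables (R : realType) (s : nat) (zeta : 'I_s -> R[i]).
Variable c : 'I_s -> {posnum R}.
Local Open Scope ereal_scope.

Definition atomic_measure (A : set (borelC R)) : \bar R :=
  \sum_(k < s) ((c k)%:num)%:E * dirac (zeta k : borelC R) A.

Let m (k : nat) : {measure set (borelC R) -> \bar R} :=
  if insub k is Some i then
    mscale (NngNum (ltW [gt0 of (c i)%:num])) (dirac (zeta i : borelC R))
  else mzero.

Let atomic_measureE : atomic_measure = msum m s.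
Proof.
apply/funext => A; apply: eq_bigr => k _.
by rewrite /m valK.
Qed.

Let atomic_measure0 : atomic_measure set0 = 0.
Proof. by rewrite atomic_measureE measure0. Qed.

Let atomic_measure_ge0 A : 0 <= atomic_measure A.
Proof. by rewrite atomic_measureE measure_ge0. Qed.

Let atomic_measure_sigma_additive : semi_sigma_additive atomic_measure.
Proof. by rewrite atomic_measureE; exact: measure_semi_sigma_additive. Qed.

HB.instance Definition _ := isMeasure.Build _ _ _ atomic_measure
  atomic_measure0 atomic_measure_ge0 atomic_measure_sigma_additive.

End atomic_measure.

Section norm.
Variables (R : realType) (s : nat) (zeta : 'I_s -> R[i]).
Implicit Types f g : R[i] -> R[i].

Definition is_Q f g := H2 g /\
  exists2 p : {poly R[i]}, (size p <= s)%N &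
    forall z, disk z ->
      f z = p.[z] + (\prod_(k < s) ('X - (zeta k)%:P)).[z] * g z.

(* Two functions g with [is_Q f g] agree on the disk, which is all that
   [H2norm] depends on. *)
Definition Qop f : R[i] -> R[i] := xget (fun=> 0) [set g | is_Q f g].

Definition Dnorm f : R :=
  Num.sqrt (\sum_(k < s) normc (radial_lim f (zeta k)) ^+ 2
            + H2norm (Qop f) ^+ 2).

Definition dist_poly f (n : nat) : R :=
  inf [set Dnorm (fun z => f z - h.[z])
      | h in [set h : {poly R[i]} | (size h <= n.+1)%N]].

(* The complete homogeneous symmetric polynomial S_k, evaluated at zeta. *)
Definition hsym (k : nat) : R[i] :=
  \sum_(t : k.-tuple 'I_s | sorted leq [seq val i | i <- t])
    \prod_(i <- t) zeta i.

Definition hsym_tail (a : nat -> R[i]) (j : nat) : nat -> R[i] :=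
  fun N => \sum_(j <= k < N) a k * hsym (k - j).

End norm.

(* Main.v *)
(* A finite weighted Dirichlet integral at an atom [zeta] says that
   [F = f' / (1 - z / zeta)] satisfies [int |F|^2 (1 - |z|^2) < oo].  Averaging
   over rotations by roots of unity (planar Lebesgue measure is invariant under
   shears, hence under rotations) turns this into
   [sum |T_m|^2 / m^2 < oo], where [T_m = sum_(k <= m) k fhat(k) zeta^k].
   Summation by parts and Hardy's inequality then give
   [f = alpha + (z - zeta) g] with [g] in H^2, and such one-point
   representations are merged by interpolation into [f = p + q g].  Dividing a
   polynomial [h] of degree at most [n] by [q] shows that the distance is
   attained when the remainder is [p] and the quotient truncates [g], so it is
   the l^2 norm of the coefficients of [g] of index at least [n + 1 - s].
   Finally [g] is recovered from [f] because the generating function of the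
   [S_k] inverts the reversed polynomial of [q]; the boundary terms of the
   truncated sums vanish because [S_k(zeta)] stays bounded when the [zeta_i]
   are distinct and unimodular. *)
Require Import Defs.
From mathcomp Require Import all_boot all_order all_algebra.
From mathcomp Require Import all_classical all_reals all_analysis.
From mathcomp Require Import all_field measurable_realfun complex ring lra zify.
Import Order.TTheory GRing.Theory Num.Theory.
Import numFieldNormedType.Exports Normc.
Set Implicit Arguments.
Unset Strict Implicit.
Unset Printing Implicit Defensive.
Local Open Scope classical_set_scope.
Local Open Scope complex_scope.
Local Open Scope ring_scope.

(** The weight [1 / m^2] is the order of the integral of [|z|^(2m) (1 - |z|^2)] over the disk,
    namely [pi / ((m + 1) (m + 2))]. Only a lower bound of this order enters, so a thin annulus
    measured by vertical sections takes the place of polar coordinates. Likewise orthogonality of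
    monomials on a circle is replaced by a finite identity over [N]-th roots of unity, with [N]
    fixed large and its error sent to 0 at the very end. The obstacle is that the coefficients of
    the quotient at one point are the tails [zeta^(-j-1) sum_(k > j) fhat(k) zeta^k], whose
    convergence is not known beforehand: the integral controls only the growing sums [T_m].
    Summation by parts rewrites the tails through [T_m / m^2], which is absolutely summable, and the
    tail form of Hardy's inequality makes them square summable. On the side of the norm,
    [taylor_coef] and [Qop] are choices, so no norm can be computed before uniqueness is known both
    for Taylor coefficients and for [p + q g]; the latter rests on the radial limits, which
    determine [p]. *)

Lemma cvg_numFieldP (K : numFieldType) (T : Type) (F : set_system T)
    {FF : Filter F} (u : T -> K) (l : K) :
  (u @ F --> l) <-> (forall e, 0 < e -> \forall t \near F, `|l - u t| < e).
Proof. by split; move/(@cvgrPdist_lt K K^o T F FF u l). Qed.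

(** * Limits in the complex plane and bounded sums *)

Section complex_limits.
Variable R : realType.
Implicit Types z w : R[i].

Lemma normc_ge0 z : 0 <= normc z.
Proof. by case: z => a b; rewrite /= sqrtr_ge0. Qed.

(** The bridge from the [R[i]]-valued norm to estimates in [R]. For the converse, a positive element
    of [R[i]] is real. *)
Lemma cvg_normc (T : Type) (F : set_system T) {FF : Filter F}
    (u : T -> R[i]) (l : R[i]) :
  (u @ F --> l) <-> (normc (u x - l) @[x --> F] --> (0 : R)).
Proof.
split=> ul.
  apply/cvgrPdist_lt => e e0.
  have := (@cvg_numFieldP R[i] T F FF u l).1 ul e%:C; rewrite ltcR => /(_ e0).
  apply: filterS => t; rewrite (_ : `|l - u t| = (normc (l - u t))%:C)// ltcR.
  rewrite sub0r normrN ger0_norm ?normc_ge0//.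
  by rewrite -normcN opprB.
apply: (@cvg_numFieldP R[i] T F FF u l).2 => -[e e'].
rewrite ltcE /= => /andP[/eqP ee e0].
move/cvgrPdist_lt: ul => /(_ e e0); apply: filterS => t.
rewrite sub0r normrN ger0_norm ?normc_ge0// -normcN opprB -ltcR => h.
by rewrite ee.
Qed.
End complex_limits.

(* Over an abstract field: on [R[i]] the unification behind these one-liners
   does not terminate in practice. *)
Section field_limit_algebra.
Variable K : numFieldType.
Context {T : Type} {F : set_system T} {FF : ProperFilter F}.
Implicit Types (u v : T -> K) (a b : K).

Lemma cvg_field_add u v a b : u @ F --> a -> v @ F --> b ->
  (u x + v x) @[x --> F] --> a + b.
Proof. exact: cvgD. Qed.

Lemma cvg_field_lim u a : u @ F --> a -> lim (u @ F) = a.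
Proof. exact: cvg_lim. Qed.

Lemma cvg_field_sub u v a b : u @ F --> a -> v @ F --> b ->
  (u x - v x) @[x --> F] --> a - b.
Proof. exact: cvgB. Qed.

Lemma cvg_field_scale u a b : u @ F --> a -> (b * u x) @[x --> F] --> b * a.
Proof. by apply: cvgM; exact: cvg_cst. Qed.
End field_limit_algebra.

Section complex_limit_algebra.
Variable R : realType.
Context {T : Type} {F : set_system T} {FF : ProperFilter F}.
Implicit Types (u v : T -> R[i]) (a b : R[i]).

Lemma cvgc_add u v a b : u @ F --> a -> v @ F --> b ->
  (u x + v x) @[x --> F] --> a + b.
Proof. exact: (@cvg_field_add R[i]). Qed.

Lemma cvgc_lim u a : u @ F --> a -> lim (u @ F) = a.
Proof. exact: (@cvg_field_lim R[i]). Qed.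

Lemma cvgc_cst a : (fun _ : T => a) @ F --> a.
Proof. exact: cvg_cst. Qed.

Lemma cvgc_scale u a b : u @ F --> a -> (b * u x) @[x --> F] --> b * a.
Proof. exact: (@cvg_field_scale R[i]). Qed.

Lemma cvgc_sub u v a b : u @ F --> a -> v @ F --> b ->
  (u x - v x) @[x --> F] --> a - b.
Proof. exact: (@cvg_field_sub R[i]). Qed.

Lemma cvgc_unique u a b : u @ F --> a -> u @ F --> b -> a = b.
Proof. by move=> ua ub; rewrite -(cvgc_lim ua) -(cvgc_lim ub). Qed.

Lemma cvgc_dominated u a (e : T -> R) :
  (forall x, normc (u x - a) <= e x) -> e @ F --> 0 -> u @ F --> a.
Proof.
move=> ue e0; apply/cvg_normc.
apply: (@squeeze_cvgr _ _ _ _ (fun _ => 0) e) => //; last exact: cvg_cst.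
by near=> x; rewrite normc_ge0 ue.
Unshelve. all: by end_near. Qed.

Lemma cvg_normc_of u a : u @ F --> a -> normc (u x) @[x --> F] --> normc a.
Proof.
move=> /cvg_normc ua; apply/cvgrPdist_le => e e0.
move/cvgrPdist_le: ua => /(_ e e0); apply: filterS => t.
rewrite sub0r normrN ger0_norm ?normc_ge0// => h; rewrite ler_distl.
have h1 := le_normcD (u t - a) a; have h2 := le_normcD (a - u t) (u t).
rewrite !subrK in h1 h2; rewrite -(normcN (a - u t)) opprB in h2.
by apply/andP; split; lra.
Qed.

End complex_limit_algebra.
Arguments cvgc_add {R T F FF u v a b} _ _.
Arguments cvgc_sub {R T F FF u v a b} _ _.
Arguments cvgc_cst {R T F FF} a.
Arguments cvgc_scale {R T F FF u a} b _.
Arguments cvgc_dominated {R T F FF u a} e _ _.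
Arguments cvgc_unique {R T F FF u a b} _ _.
Arguments cvg_normc_of {R T F FF u a} _.
Arguments cvgc_lim {R T F FF u a} _.

Section modulus.
Variable R : realType.
Implicit Types z w : R[i].

Lemma normcX z n : normc (z ^+ n) = normc z ^+ n.
Proof. by elim: n => [|n IH]; rewrite ?expr0 ?normc1// !exprS normcM IH. Qed.

Lemma normc_real (x : R) : normc x%:C = `|x|.
Proof. by rewrite /= expr0n /= addr0 sqrtr_sqr. Qed.

Lemma normc_nat n : normc (n%:R : R[i]) = n%:R.
Proof. by rewrite -(rmorph_nat (real_complex R)) normc_real ger0_norm. Qed.

Lemma normc_sum I (r : seq I) (P : pred I) (F : I -> R[i]) :
  normc (\sum_(i <- r | P i) F i) <= \sum_(i <- r | P i) normc (F i).
Proof.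
elim/big_ind2: _ => [|x1 x2 y1 y2 h1 h2|//]; first by rewrite normc0.
by rewrite (le_trans (le_normcD _ _))// lerD.
Qed.

Lemma ler_normcB z w : normc z - normc w <= normc (z - w).
Proof. by have := le_normcD (z - w) w; rewrite subrK lerBlDr. Qed.

Lemma normcBC z w : normc (z - w) = normc (w - z).
Proof. by rewrite -normcN opprB. Qed.

Lemma sqr_normc_ReIm z : normc z ^+ 2 = complex.Re z ^+ 2 + complex.Im z ^+ 2.
Proof. by case: z => a b /=; rewrite sqr_sqrtr// addr_ge0 ?sqr_ge0. Qed.

Lemma normc_ge_absRe z : `|complex.Re z| <= normc z.
Proof.
rewrite -(ler_pXn2r (n := 2))// ?nnegrE ?normc_ge0//.
by rewrite real_normK ?num_real// sqr_normc_ReIm lerDl sqr_ge0.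
Qed.

Lemma normc_ge_absIm z : `|complex.Im z| <= normc z.
Proof.
rewrite -(ler_pXn2r (n := 2))// ?nnegrE ?normc_ge0//.
by rewrite real_normK ?num_real// sqr_normc_ReIm lerDr sqr_ge0.
Qed.

Lemma normc_le_ReIm z : normc z <= `|complex.Re z| + `|complex.Im z|.
Proof.
rewrite -(ler_pXn2r (n := 2))// ?nnegrE ?normc_ge0 ?addr_ge0//.
rewrite sqr_normc_ReIm -(real_normK (num_real (complex.Re z))).
rewrite -(real_normK (num_real (complex.Im z))).
have := normr_ge0 (complex.Re z); have := normr_ge0 (complex.Im z); nra.
Qed.

Lemma normc_eq0 z : normc z = 0 -> z = 0.
Proof. exact: eq0_normc. Qed.

Lemma sqr_normcD_le z w : normc (z + w) ^+ 2 <= 2 * normc z ^+ 2 + 2 * normc w ^+ 2.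
Proof.
have h := le_normcD z w; have h0 := normc_ge0 (z + w).
have : normc (z + w) ^+ 2 <= (normc z + normc w) ^+ 2 by rewrite ler_pXn2r// nnegrE; lra.
have := sqr_ge0 (normc z - normc w); lra.
Qed.
End modulus.

Section bounded_sums.
Variable R : realType.
Implicit Types u v : nat -> R.

(** For nonnegative terms this is convergence; in this form comparison, shifts and sums need no
    limit. *)
Definition sum_bounded u := exists M, forall N, \sum_(0 <= j < N) u j <= M.

Lemma sum_boundedP u : (forall j, 0 <= u j) -> sum_bounded u <-> cvgn (series u).
Proof.
move=> u0; have ndu : {homo series u : n m / (n <= m)%N >-> n <= m}.
  exact: nondecreasing_series.
split=> [[M uM]|cu].
  by apply: nondecreasing_is_cvgn => //; exists M => _ [N _ <-]; exact: uM.
by exists (limn (series u)) => N; exact: nondecreasing_cvgn_le.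
Qed.

Lemma sum_bounded_le u v : (forall j, u j <= v j) -> sum_bounded v -> sum_bounded u.
Proof.
by move=> uv [M vM]; exists M => N; rewrite (le_trans _ (vM N))// ler_sum.
Qed.

Lemma sum_boundedD u v : sum_bounded u -> sum_bounded v ->
  sum_bounded (fun j => u j + v j).
Proof.
by move=> [M uM] [L vL]; exists (M + L) => N; rewrite big_split/= lerD.
Qed.

Lemma sum_boundedZ (c : R) u : 0 <= c -> sum_bounded u ->
  sum_bounded (fun j => c * u j).
Proof.
by move=> c0 [M uM]; exists (c * M) => N; rewrite -mulr_sumr ler_wpM2l.
Qed.

Lemma sum_bounded_shift u m : (forall j, 0 <= u j) -> sum_bounded u ->
  sum_bounded (fun j => u (j + m)%N).
Proof.
move=> u0 [M uM]; exists M => N; rewrite (le_trans _ (uM (N + m)%N))//.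
rewrite [leRHS](big_cat_nat (n := m))//= ?leq_addl//.
have -> : \sum_(m <= j < N + m) u j = \sum_(0 <= j < N) u (j + m)%N.
  by rewrite -{1}(add0n m) big_addn addnK.
by rewrite lerDr sumr_ge0.
Qed.

Lemma sum_bounded_cons x u : (forall j, 0 <= u j) -> sum_bounded u ->
  sum_bounded (fun j => if j is k.+1 then u k else x).
Proof.
move=> u0 [M uM]; exists (`|x| + M) => -[|N].
  by rewrite big_geq// addr_ge0// (le_trans _ (uM 0%N))// big_geq.
by rewrite big_nat_recl//= lerD ?ler_norm.
Qed.

Lemma sum_bounded_cvg0 u : (forall j, 0 <= u j) -> sum_bounded u ->
  u @ \oo --> 0.
Proof. by move=> u0 /(sum_boundedP u0); exact: cvg_series_cvg_0. Qed.

Lemma sum_bounded_tail u (e : R) : (forall j, 0 <= u j) -> sum_bounded u -> 0 < e ->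
  exists N, forall m, \sum_(N <= j < m) u j <= e.
Proof.
move=> u0 ub e0; have cu := (sum_boundedP u0).1 ub.
have /cvgrPdist_le/(_ e e0)[N _ Nu] := cu.
exists N => m; case: (leqP N m) => Nm; last by rewrite big_geq ?ltW// ltnW.
have := Nu N (leqnn N); have := Nu m Nm.
have ndu := nondecreasing_series (fun k _ _ => u0 k) : {homo series u : n m / (n <=
  m)%N >-> n <= m}.
have l1 := nondecreasing_cvgn_le ndu cu m.
have l2 := nondecreasing_cvgn_le ndu cu N.
rewrite !ger0_norm ?subr_ge0// => h1 h2.
have : series u m = series u N + \sum_(N <= j < m) u j by rewrite /series/= -big_cat_nat.
lra.
Qed.

Lemma sum_bounded_geometric (r : R) : 0 <= r -> r < 1 -> sum_bounded (fun j => r ^+ j).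
Proof.
move=> r0 r1; exists (1 - r)^-1 => N; rewrite -[leRHS]mul1r ler_pdivlMr ?subr_gt0//.
suff -> : (\sum_(0 <= j < N) r ^+ j) * (1 - r) = 1 - r ^+ N by rewrite gerBl exprn_ge0.
elim: N => [|N IH]; first by rewrite big_geq// mul0r expr0 subrr.
by rewrite big_nat_recr//= mulrDl IH exprS; ring.
Qed.

Lemma sum_bounded_ge u : (forall j, 0 <= u j) -> sum_bounded u ->
  exists2 M, 0 <= M & forall j, u j <= M.
Proof.
move=> u0 [M uM]; exists M; first by rewrite (le_trans _ (uM 0%N))// big_geq.
by move=> k; rewrite (le_trans _ (uM k.+1))// big_nat_recr//= lerDr sumr_ge0.
Qed.
End bounded_sums.

(** * Power series on the disk *)

Section power_series.
Variable R : realType.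
Implicit Types (z w : R[i]) (f g : R[i] -> R[i]) (a b : nat -> R[i]).

Lemma cvgc_normc_le (u : nat -> R[i]) (l b : R[i]) (e : R) N :
  u @ \oo --> l -> (forall n, (N <= n)%N -> normc (u n - b) <= e) ->
  normc (l - b) <= e.
Proof.
move=> ul ue; have ulb : normc (u n - b) @[n --> \oo] --> normc (l - b).
  exact: cvg_normc_of (cvgc_sub ul (cvgc_cst b)).
rewrite -(cvg_lim _ ulb)//; apply: limr_le; first by apply/cvg_ex; eexists; exact: ulb.
by exists N => // n /= Nn; exact: ue.
Qed.

Lemma cvgc_ReIm (u : nat -> R[i]) (x y : R) :
  (fun n => complex.Re (u n)) @ \oo --> x -> (fun n => complex.Im (u n)) @ \oo --> y ->
  u @ \oo --> (x +i* y)%C.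
Proof.
move=> ux uy; apply: (cvgc_dominated
  (fun n => `|complex.Re (u n) - x| + `|complex.Im (u n) - y|)).
  by move=> n; have := normc_le_ReIm (u n - (x +i* y)%C); case: (u n).
rewrite -(addr0 (0 : R)); apply: cvgD.
- by apply/norm_cvg0P/subr_cvg0.
- by apply/norm_cvg0P/subr_cvg0.
Qed.

Lemma cvgc_series a : sum_bounded (fun j => normc (a j)) ->
  exists l : R[i], series a @ \oo --> l.
Proof.
move=> sa.
have cR (p : {additive R[i] -> R}) : (forall z, `|p z| <= normc z) ->
    cvgn (fun n => p (series a n)).
  move=> pl; rewrite (_ : (fun _ => _) = series (fun j => p (a j))); last first.
    by apply/funext => n; rewrite /series/= raddf_sum.
  apply: normed_cvg; apply/(@sum_boundedP R (fun j => `|p (a j)|)) => //.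
  exact: sum_bounded_le sa.
have hR := cR (@complex.Re R) (@normc_ge_absRe R).
have hI := cR (@complex.Im R) (@normc_ge_absIm R).
by eexists; apply: cvgc_ReIm; [exact: hR|exact: hI].
Qed.

(** Radius of convergence at least 1, through absolute summability; [disk_bounded] is the same
    condition through bounded terms, which is easier to establish. *)
Definition disk_summable a := forall r : R, 0 <= r -> r < 1 ->
  sum_bounded (fun j => normc (a j) * r ^+ j).

Definition disk_bounded a := forall r : R, 0 <= r -> r < 1 ->
  exists2 M, 0 <= M & forall j, normc (a j) * r ^+ j <= M.

(** A bound on the terms at the intermediate radius [q = (r + 1) / 2] leaves a geometric series of
    ratio [r / q < 1] at radius [r]. *)
Lemma disk_summableP a : disk_summable a <-> disk_bounded a.
Proof.
split=> [sa r r0 r1|ba r r0 r1].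
  apply: sum_bounded_ge (sa r r0 r1) => j.
  by rewrite mulr_ge0 ?normc_ge0 ?exprn_ge0.
pose q := (r + 1) / 2; have q0 : 0 < q by rewrite /q; lra.
have q1 : q < 1 by rewrite /q; lra.
have [M M0 hM] := ba q (ltW q0) q1.
have t1 : r / q < 1 by rewrite ltr_pdivrMr// mul1r /q; lra.
have t0 : 0 <= r / q by rewrite divr_ge0// ltW.
apply: (sum_bounded_le _ (sum_boundedZ M0 (sum_bounded_geometric t0 t1))) => j.
rewrite -{1}(divfK (lt0r_neq0 q0) r) exprMn mulrCA mulrC.
by rewrite ler_wpM2r// exprn_ge0.
Qed.

Lemma bounded_disk_bounded a (M : R) : 0 <= M -> (forall j, normc (a j) <= M) ->
  disk_bounded a.
Proof.
move=> M0 aM r r0 r1; exists M => // j; rewrite -[leRHS]mulr1 ler_pM ?normc_ge0//.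
  by rewrite exprn_ge0.
by rewrite exprn_ile1// ltW.
Qed.

(** The terms at the real point [r] are differences of consecutive partial sums, hence tend to 0 and
    are bounded. *)
Lemma taylor_disk_summable f a : taylor_on_disk f a -> disk_summable a.
Proof.
move=> fa; apply/disk_summableP => r r0 r1.
have dr : disk r%:C by rewrite /disk/= -[X in X < _]/(normc r%:C) normc_real ger0_norm.
have hs := fa _ dr.
have hs1 : (fun n => series (fun j => a j * r%:C ^+ j) n.+1) @ \oo --> f r%:C.
  by move: hs; rewrite -cvg_shiftS.
have : normc (series (fun j => a j * r%:C ^+ j) n.+1 -
    series (fun j => a j * r%:C ^+ j) n) @[n --> \oo] --> normc (f r%:C - f r%:C).
  exact: cvg_normc_of (cvgc_sub hs1 hs).
rewrite subrr normc0.
rewrite (_ : (fun _ => _) = (fun j => normc (a j) * r ^+ j)); last first.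
  apply/funext => n; rewrite /series/= big_nat_recr//= addrAC subrr add0r.
  by rewrite normcM normcX normc_real ger0_norm.
move=> h; have /cvg_seq_bounded/pinfty_ex_gt0[M M0 hM] : cvgn (fun j => normc (a j) *
  r ^+ j).
  by apply/cvg_ex; exists 0.
exists M; first exact: ltW.
by move=> j; have /= := hM j I; rewrite ger0_norm ?mulr_ge0 ?normc_ge0 ?exprn_ge0.
Qed.

Lemma disk_summable_taylor a : disk_summable a -> exists f, taylor_on_disk f a.
Proof.
move=> sa.
have /choice[f hf] : forall z, exists l : R[i], disk z -> series (fun j => a j * z ^+
  j) @ \oo --> l.
  move=> z; have [dz|ndz] := pselect (disk z); last by exists 0.
  have [l hl] : exists l : R[i], series (fun j => a j * z ^+ j) @ \oo --> l.
    apply: cvgc_series; apply: sum_bounded_le (sa _ (normc_ge0 z) dz) => j.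
    by rewrite normcM normcX.
  by exists l.
by exists f.
Qed.

Lemma taylor_tail f a z (N : nat) (e : R) : taylor_on_disk f a -> disk z ->
  (forall m, \sum_(N <= j < m) normc (a j) * normc z ^+ j <= e) ->
  normc (f z - \sum_(0 <= j < N) a j * z ^+ j) <= e.
Proof.
move=> fa dz he; apply: (cvgc_normc_le (N := N) (fa z dz)) => n Nn.
rewrite /series/= (big_cat_nat (n := N))//= addrAC subrr add0r.
rewrite (le_trans (normc_sum _ _ _))// (le_trans _ (he n))// ler_sum// => j _.
by rewrite normcM normcX.
Qed.

Lemma taylor_ext f g a : {in disk, f =1 g} -> taylor_on_disk f a -> taylor_on_disk g a.
Proof. by move=> fg fa z dz; rewrite -fg ?inE//; exact: fa. Qed.

Lemma taylor_add f g a b : taylor_on_disk f a -> taylor_on_disk g b ->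
  taylor_on_disk (fun z => f z + g z) (fun j => a j + b j).
Proof.
move=> fa gb z dz.
have -> : series (fun j => (a j + b j) * z ^+ j) =
    (fun n => series (fun j => a j * z ^+ j) n + series (fun j => b j * z ^+ j) n).
  apply/funext => n; rewrite /series/= -big_split/=.
  by apply: eq_bigr => j _; rewrite mulrDl.
exact: cvgc_add (fa z dz) (gb z dz).
Qed.

Lemma taylor_scale f a c : taylor_on_disk f a ->
  taylor_on_disk (fun z => c * f z) (fun j => c * a j).
Proof.
move=> fa z dz.
have -> : series (fun j => (c * a j) * z ^+ j) =
    (fun n => c * series (fun j => a j * z ^+ j) n).
  apply/funext => n; rewrite /series/= mulr_sumr.
  by apply: eq_bigr => j _; rewrite mulrA.
exact: cvgc_scale (fa z dz).
Qed.

Lemma taylor_sub f g a b : taylor_on_disk f a -> taylor_on_disk g b ->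
  taylor_on_disk (fun z => f z - g z) (fun j => a j - b j).
Proof.
move=> fa gb z dz.
have -> : series (fun j => (a j - b j) * z ^+ j) =
    (fun n => series (fun j => a j * z ^+ j) n - series (fun j => b j * z ^+ j) n).
  apply/funext => n; rewrite /series/= -sumrB.
  by apply: eq_bigr => j _; rewrite mulrBl.
exact: cvgc_sub (fa z dz) (gb z dz).
Qed.

Definition seq_cons (c : R[i]) a : nat -> R[i] := fun j => if j is k.+1 then a k else c.

Lemma taylor_cons f a c : taylor_on_disk f a ->
  taylor_on_disk (fun z => c + z * f z) (seq_cons c a).
Proof.
move=> fa z dz; rewrite -cvg_shiftS.
have -> : (fun n => series (fun j => seq_cons c a j * z ^+ j) n.+1) =
    (fun n => c + z * series (fun j => a j * z ^+ j) n).
  apply/funext => n; rewrite /series/= big_nat_recl//= expr0 mulr1 mulr_sumr.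
  by congr (_ + _); apply: eq_bigr => j _; rewrite exprS mulrCA.
exact: cvgc_add (cvgc_cst c) (cvgc_scale z (fa z dz)).
Qed.

Lemma taylor_poly (p : {poly R[i]}) : taylor_on_disk (horner p) (fun j => p`_j).
Proof.
move=> z _; apply: (cvgc_dominated
  (fun n => if (n < size p)%N then normc (series (fun j => p`_j * z ^+ j) n - p.[z])
    else 0)).
  move=> n; case: ltnP => // sn; rewrite (_ : series _ n = p.[z]) ?subrr ?normc0//.
  by rewrite /series/= big_mkord (horner_coef_wide z sn).
apply: cvg_near_cst; exists (size p) => // n /= sn; by rewrite ltnNge sn.
Qed.

(** Once the differences [d j] vanish for [j < m], evaluation at a small real [t] gives
    [|d m| t^m <= t^(m+1) 2^(m+1) C], where [C] bounds the series of [|d j| 2^-j]; then [t] tends to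
    0. *)
Lemma taylor_unique f a b : taylor_on_disk f a -> taylor_on_disk f b -> a = b.
Proof.
move=> fa fb.
have := taylor_sub fa fb; set d := (fun j => a j - b j) => fd.
suff d0 : forall m, d m = 0.
  by apply/funext => j; apply/eqP; rewrite -subr_eq0; apply/eqP; exact: d0.
elim/ltn_ind => m IH.
have hh : (0 : R) <= 2^-1 by rewrite invr_ge0.
have h1 : (2^-1 : R) < 1 by rewrite invf_lt1 ?ltr1n.
have [C hC] := taylor_disk_summable fd hh h1.
have key (t : R) : 0 < t -> t <= 2^-1 -> normc (d m) <= t * (2 ^+ m.+1 * C).
  move=> t0 t12; have dt : disk t%:C.
    by rewrite /disk/= -[X in X < _]/(normc t%:C) normc_real gtr0_norm//; lra.
  have : normc (f t%:C - f t%:C - d m * t%:C ^+ m) <= t ^+ m.+1 * (2 ^+ m.+1 * C).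
    apply: (cvgc_normc_le (N := m.+1) (fd _ dt)) => n mn.
    rewrite /series/= (big_cat_nat (n := m.+1))//= big_nat_recr//=.
    rewrite big_nat big1 ?add0r; last by move=> j /= jm; rewrite IH ?mul0r.
    rewrite addrAC subrr add0r (le_trans (normc_sum _ _ _))//.
    apply: le_trans (_ : t ^+ m.+1 * (2 ^+ m.+1 * \sum_(m.+1 <= j < n) normc (d j) *
      2^-1 ^+ j) <= _); last first.
      apply: ler_wpM2l; first by rewrite exprn_ge0// ltW.
      apply: ler_wpM2l; first by rewrite exprn_ge0.
      rewrite (le_trans _ (hC n))// [leRHS](big_cat_nat (n := m.+1))//= lerDr
        sumr_ge0// => j _.
      by rewrite mulr_ge0 ?normc_ge0 ?exprn_ge0.
    rewrite !mulr_sumr !big_nat; apply: ler_sum => j /andP[mj _].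
    rewrite normcM normcX normc_real gtr0_norm//.
    have [k ->] : exists k, j = (k + m.+1)%N by exists (j - m.+1)%N; rewrite subnK.
    have -> : normc (d (k + m.+1)%N) * t ^+ (k + m.+1) =
      t ^+ m.+1 * normc (d (k + m.+1)%N) * t ^+ k by rewrite exprD; ring.
    have -> : t ^+ m.+1 * (2 ^+ m.+1 * (normc (d (k + m.+1)%N) * 2^-1 ^+ (k + m.+1))) =
      t ^+ m.+1 * normc (d (k + m.+1)%N) * 2^-1 ^+ k.
      by rewrite exprD !exprVn; field; rewrite !expf_neq0.
    apply: ler_wpM2l; first by rewrite mulr_ge0 ?normc_ge0// exprn_ge0// ltW.
    by apply: lerXn2r => //; rewrite nnegrE ltW.
  rewrite subrr sub0r normcN normcM normcX normc_real gtr0_norm// exprS -mulrA.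
  rewrite [leLHS]mulrC (_ : t * _ = t ^+ m * (t * (2 ^+ m.+1 * C))); last by ring.
  by rewrite ler_pM2l ?exprn_gt0.
apply: normc_eq0; apply/eqP; rewrite eq_le normc_ge0 andbT.
apply/ler_addgt0Pr => e e0; rewrite add0r.
pose B := 2 ^+ m.+1 * `|C| + 1; have B1 : 1 <= B by rewrite lerDr mulr_ge0 ?exprn_ge0.
pose t := Num.min (2^-1) (e / B).
have t0 : 0 < t by rewrite lt_min invr_gt0 ltr0n divr_gt0//; lra.
apply: (le_trans (key t t0 _)); first by rewrite ge_min lexx.
apply: le_trans (_ : e / B * B <= _); last by rewrite divfK//; lra.
apply: le_trans (_ : t * B <= _); last first.
  by rewrite ler_wpM2r//; [lra|rewrite ge_min lexx orbT].
rewrite ler_wpM2l ?ltW// /B; have := ler_norm C.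
have : (0 : R) <= 2 ^+ m.+1 by rewrite exprn_ge0.
nra.
Qed.
End power_series.
Arguments cvgc_normc_le {R u l b e} N _ _.
Arguments taylor_cons {R f a} c _.
Arguments taylor_scale {R f a} c _.
Arguments taylor_add {R f g a b} _ _.
Arguments taylor_sub {R f g a b} _ _.
Arguments taylor_poly {R} p.
Arguments taylor_unique {R f a b} _ _.
Arguments taylor_disk_summable {R f a} _ [r] _ _.
Arguments taylor_ext {R f g a} _ _.

(** * Rotation invariance of planar Lebesgue measure *)

Section shears.
Variable R : realType.
Local Notation mu := (@lebesgue_measure R).
Local Notation mu2 := (@lebesgue_measure R \x @lebesgue_measure R)%E.
Local Notation plane := (measurableTypeR R * measurableTypeR R)%type.

(** Translation preserves lengths of intervals, and these determine the measure. *)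
Lemma lebesgue_measure_translate (c : R) (A : set R) : measurable A ->
  pushforward mu ((fun y => y + c) : _ -> measurableTypeR R) A = mu A.
Proof.
have mtr : measurable_fun setT ((fun y : R => y + c) : measurableTypeR R ->
  measurableTypeR R).
  by apply: measurable_funD => //; exact: measurable_cst.
move=> mA; apply/esym/lebesgue_measure_unique => //= _ [[a b]] _ <-.
rewrite /pushforward (_ : _ @^-1` _ = `](a - c), (b - c)]%classic); last first.
  by apply/seteqP; split => y /=; rewrite !in_itv/= ltrBlDr lerBrDr.
rewrite !lebesgue_measure_itv/= !lte_fin ltrD2r; case: ifPn => // _.
by rewrite -!EFinB; congr EFin; ring.
Qed.

Definition shear_snd (a : R) (p : plane) : plane := (p.1, p.2 + a * p.1).
Definition shear_fst (a : R) (p : plane) : plane := (p.1 + a * p.2, p.2).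

Lemma measurable_shear_snd a : measurable_fun setT (shear_snd a).
Proof.
apply: measurable_fun_pair; first exact: measurable_fst.
apply: measurable_funD; first exact: measurable_snd.
apply: measurable_funM; first exact: measurable_cst.
exact: measurable_fst.
Qed.

Lemma measurable_shear_fst a : measurable_fun setT (shear_fst a).
Proof.
apply: measurable_fun_pair; last exact: measurable_snd.
apply: measurable_funD; first exact: measurable_fst.
apply: measurable_funM; first exact: measurable_cst.
exact: measurable_snd.
Qed.

Lemma shear_snd_preserves a (A : set plane) : measurable A ->
  mu2 (shear_snd a @^-1` A) = mu2 A.
Proof.
move=> mA; rewrite /product_measure1; apply: eq_integral => x _ /=.
rewrite -(lebesgue_measure_translate (a * x) (measurable_xsection _ mA)).
by rewrite /pushforward; congr (mu _).
Qed.

(** Here the horizontal sections are the translated ones, so the product measure is first rewritten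
    with the order of integration exchanged. *)
Lemma shear_fst_preserves a (A : set plane) : measurable A ->
  mu2 (shear_fst a @^-1` A) = mu2 A.
Proof.
have E (B : set plane) : measurable B -> mu2 B = product_measure2 mu mu B.
  move=> mB; apply: (@product_measure_unique _ _ _ _ _ mu mu) => // X Y mX mY.
  exact: product_measure2E.
move=> mA; rewrite !E//; last first.
  by rewrite -[X in measurable X]setTI; exact: measurable_shear_fst.
rewrite /product_measure2; apply: eq_integral => y _ /=.
rewrite -(lebesgue_measure_translate (a * y) (measurable_ysection _ mA)).
by rewrite /pushforward; congr (mu _).
Qed.
End shears.

(** * Roots of unity and Parseval on the cyclic group *)

Lemma prim_root_exists_closed (K : numClosedFieldType) n : (0 < n)%N ->
  exists z : K, n.-primitive_root z.
Proof.
move=> n_gt0; have [r] := closed_field_poly_normal ('X^n - 1 : {poly K}).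
rewrite (monicP _) ?monicXnsubC// scale1r => Dp.
have rn1 : all n.-unity_root r by apply/allP=> z; rewrite -root_prod_XsubC -Dp.
have sz_r : (n < (size r).+1)%N by rewrite -(size_prod_XsubC r id) -Dp size_XnsubC.
(* The multiplicative structure is cyclic: [n] distinct [n]-th roots of unity include a primitive
   one. Distinctness is the separability of ['X^n - 1]. *)
have [|z] := hasP (cyclic.has_prim_root n_gt0 rn1 _ sz_r); last by exists z.
by rewrite -separable_prod_XsubC -Dp separable_Xn_sub_1// pnatr_eq0 -lt0n.
Qed.

Section roots_of_unity.
Variable R : realType.

Lemma normc_prim_root n (w : R[i]) : n.-primitive_root w -> normc w = 1.
Proof.
move=> pw; have n0 := prim_order_gt0 pw.
have : normc w ^+ n = 1 by rewrite -normcX (prim_expr_order pw) normc1.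
by move/eqP; rewrite pexpr_eq1 ?normc_ge0// => /eqP.
Qed.

Lemma prim_root_neqN1 n (w : R[i]) : n.-primitive_root w -> (2 < n)%N -> w != -1.
Proof.
move=> pw n2; apply/eqP => wN1; have := eq_prim_root_expr pw 2 0.
by rewrite wN1 expr0 sqrrN expr1n eqxx modn_small// mod0n.
Qed.

(** Orthogonality of characters: the sum is geometric of ratio [v = w^j / w^k], where [v^n = 1], and
    [v = 1] only for [j = k] because [j, k < n]. *)
Lemma prim_root_sum n (w : R[i]) (j k : nat) : n.-primitive_root w ->
  (j < n)%N -> (k < n)%N ->
  \sum_(l < n) (w ^+ l) ^+ j * ((w ^+ l) ^+ k)^* = (n * (j == k))%:R.
Proof.
move=> pw jn kn; pose v := w ^+ j / w ^+ k.
have w0 : w != 0 by rewrite -normr_eq0 (_ : `|w| = (normc w)%:C)// (normc_prim_root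
  pw) oner_eq0.
have E l : (w ^+ l) ^+ j * ((w ^+ l) ^+ k)^* = v ^+ l.
  rewrite -!exprM.
  have : w ^+ (l * k) * (w ^+ (l * k))^* = 1.
    rewrite -normCK (_ : `|_| = (normc (w ^+ (l * k)))%:C)//.
    by rewrite normcX (normc_prim_root pw) expr1n expr1n.
  move=> h; have -> : (w ^+ (l * k))^* = (w ^+ (l * k))^-1.
    by apply: (mulfI (expf_neq0 (l * k) w0)); rewrite h divff// expf_neq0.
  by rewrite /v expr_div_n -!exprM [(j * l)%N]mulnC [(k * l)%N]mulnC.
under eq_bigr do rewrite E.
case: (eqVneq j k) => [jk|jk].
  under eq_bigr do rewrite /v jk divff ?expf_neq0// expr1n.
  by rewrite sumr_const card_ord muln1.
rewrite muln0.
have v1 : v - 1 != 0.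
  rewrite subr_eq0; apply: contra jk => /eqP v1.
  have : w ^+ j == w ^+ k by rewrite -(divfK (expf_neq0 k w0) (w ^+ j)) -/v v1 mul1r.
  by rewrite (eq_prim_root_expr pw) !modn_small.
apply: (mulfI v1); rewrite mulr0 -subrX1 /v expr_div_n -!exprM.
by rewrite [(j * n)%N]mulnC [(k * n)%N]mulnC !exprM (prim_expr_order pw) !expr1n
  divff ?subrr ?oner_neq0.
Qed.

Lemma sqr_normcC (z : R[i]) : (normc z ^+ 2)%:C = z * z^*.
Proof. by rewrite -normCK (_ : `|z| = (normc z)%:C)// rmorphXn. Qed.

Lemma prim_root_parseval n (w : R[i]) (a : nat -> R[i]) : n.-primitive_root w ->
  \sum_(l < n) normc (\sum_(j < n) a j * (w ^+ l) ^+ j) ^+ 2 =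
  n%:R * \sum_(j < n) normc (a j) ^+ 2.
Proof.
move=> pw; apply: (@complexI R); rewrite rmorphM !rmorph_sum/= rmorph_nat.
under eq_bigr do rewrite sqr_normcC rmorph_sum big_distrlr/=.
rewrite exchange_big mulr_sumr; apply: eq_bigr => j _ /=.
rewrite exchange_big/= (bigD1 j)//= [X in _ + X]big1 ?addr0; last first.
  move=> k kj.
  have jk : (j == k :> nat) = false by rewrite eq_sym; exact: negbTE.
  transitivity (a j * (a k)^* * \sum_(l < n) (w ^+ l) ^+ j * ((w ^+ l) ^+ k)^*).
    by rewrite mulr_sumr; apply: eq_bigr => l _; rewrite rmorphM; ring.
  by rewrite (prim_root_sum pw)// jk muln0 mulr0.
rewrite sqr_normcC mulrC.
have <- : \sum_(l < n) (w ^+ l) ^+ j * ((w ^+ l) ^+ j)^* = n%:R.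
  by rewrite (prim_root_sum pw)// eqxx muln1.
by rewrite mulr_sumr; apply: eq_bigr => l _; rewrite rmorphM; ring.
Qed.
End roots_of_unity.

(** * Rotations of the plane and measurability of power series *)

Section rotations.
Variable R : realType.
Local Notation mu2 := (@lebesgue_measure R \x @lebesgue_measure R)%E.
Local Notation plane := (measurableTypeR R * measurableTypeR R)%type.

Definition area_preserving (phi : plane -> plane) :=
  measurable_fun setT phi /\
  forall A, measurable A -> mu2 (phi @^-1` A) = mu2 A.

Lemma area_preserving_comp phi psi : area_preserving phi ->
  area_preserving psi -> area_preserving (phi \o psi).
Proof.
move=> [mphi aphi] [mpsi apsi]; split; first exact: measurableT_comp.
move=> A mA; rewrite comp_preimage apsi ?aphi//.
by rewrite -[X in measurable X]setTI; exact: mphi.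
Qed.

Lemma area_preserving_integral phi (D : set plane) (f : plane -> \bar R) :
  area_preserving phi -> measurable D -> measurable_fun D f ->
  (forall p, D p -> 0 <= f p)%E ->
  (\int[mu2]_(p in phi @^-1` D) f (phi p) = \int[mu2]_(p in D) f p)%E.
Proof.
move=> [mphi aphi] mD mf f0.
have f0' : {in D, forall p, 0 <= f p}%E by move=> p /[!inE]; exact: f0.
have <- := @ge0_integral_pushforward _ _ _ _ R phi mphi mu2 D f mD mf f0'.
by apply: eq_measure_integral => A mA _; exact: aphi.
Qed.

Definition cplane (p : R * R) : R[i] := (p.1 +i* p.2)%C.

Definition rotate (w : R[i]) (p : plane) : plane :=
  (complex.Re (w * cplane p), complex.Im (w * cplane p)).

Lemma cplane_rotate w p : cplane (rotate w p) = w * cplane p.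
Proof. by rewrite /cplane /rotate /=; case: (w * _). Qed.

(* A rotation other than the half turn is a product of three shears. *)
Lemma area_preserving_rotate (w : R[i]) : normc w = 1 -> w != -1 ->
  area_preserving (rotate w).
Proof.
case: w => c s cs1 wN1.
have {}cs1 : c ^+ 2 + s ^+ 2 = 1.
  have := sqr_normc_ReIm (c +i* s)%C; rewrite cs1 expr1n /= => ->.
  by [].
have c1 : 1 + c != 0.
  apply: contra wN1 => /eqP c1; have cE : c = -1 by lra.
  move: cs1; rewrite cE sqrrN expr1n => s0; apply/eqP.
  have /eqP : s ^+ 2 = 0 by lra.
  by rewrite sqrf_eq0 => /eqP ->; apply/eqP; rewrite eq_complex /= oppr0 !eqxx.
(* The tangent of half the angle, finite away from the half turn. *)
pose t := s / (1 + c).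
have -> : rotate (c +i* s)%C = shear_fst (- t) \o (shear_snd s \o shear_fst (- t)).
  apply/funext => -[x y]; rewrite /rotate /shear_fst /shear_snd /cplane /=.
  have st : s * t = 1 - c.
    by rewrite /t; apply: (mulfI c1); rewrite mulrA mulrCA divff// mulr1; lra.
  have tc : t * c = s - t by rewrite /t; field.
  have sE : y + s * (x + - t * y) = s * x + c * y.
    by rewrite mulrDr mulrA mulrN st; ring.
  rewrite sE; congr pair; last by ring.
  rewrite (_ : - t * (s * x + c * y) = - (s * t) * x - (t * c) * y); last by ring.
  by rewrite st tc; ring.
apply: area_preserving_comp.
  by split; [exact: measurable_shear_fst|exact: shear_fst_preserves].
apply: area_preserving_comp.
  by split; [exact: measurable_shear_snd|exact: shear_snd_preserves].
by split; [exact: measurable_shear_fst|exact: shear_fst_preserves].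
Qed.

(** Stated on real and imaginary parts, so that measurability is only ever discussed for real
    functions. *)
Definition measurable_cfun (D : set plane) (G : plane -> R[i]) :=
  measurable_fun D (fun p => complex.Re (G p)) /\
  measurable_fun D (fun p => complex.Im (G p)).

Lemma measurable_cfun_cplane D : measurable_cfun D cplane.
Proof.
split; rewrite /cplane/=; apply: measurable_funTS; [exact: measurable_fst|exact:
  measurable_snd].
Qed.

Lemma measurable_cfun_cst D c : measurable_cfun D (fun=> c).
Proof. by split; exact: measurable_cst. Qed.

Lemma measurable_cfunD D G H : measurable_cfun D G -> measurable_cfun D H ->
  measurable_cfun D (fun p => G p + H p).
Proof.
move=> [G1 G2] [H1 H2]; split.
  rewrite (_ : (fun _ => _) = (fun p => complex.Re (G p) + complex.Re (H p))).
    exact: measurable_funD.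
  by apply/funext => p; case: (G p); case: (H p).
rewrite (_ : (fun _ => _) = (fun p => complex.Im (G p) + complex.Im (H p))).
  exact: measurable_funD.
by apply/funext => p; case: (G p); case: (H p).
Qed.

Lemma measurable_cfunM D G H : measurable_cfun D G -> measurable_cfun D H ->
  measurable_cfun D (fun p => G p * H p).
Proof.
move=> [G1 G2] [H1 H2]; split.
  rewrite (_ : (fun _ => _) = (fun p => complex.Re (G p) * complex.Re (H p) -
      complex.Im (G p) * complex.Im (H p))).
    by apply: measurable_funB; exact: measurable_funM.
  by apply/funext => p; case: (G p); case: (H p).
rewrite (_ : (fun _ => _) = (fun p => complex.Re (G p) * complex.Im (H p) +
    complex.Im (G p) * complex.Re (H p))).
  by apply: measurable_funD; exact: measurable_funM.
by apply/funext => p; case: (G p) => ? ?; case: (H p) => ? ?.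
Qed.

Lemma measurable_cfunX D G n : measurable_cfun D G ->
  measurable_cfun D (fun p => G p ^+ n).
Proof.
move=> mG; elim: n => [|n IH].
  under [X in measurable_cfun _ X]eq_fun do rewrite expr0.
  exact: measurable_cfun_cst.
under [X in measurable_cfun _ X]eq_fun do rewrite exprS.
exact: measurable_cfunM.
Qed.

Lemma measurable_cfun_cvg D (G : nat -> plane -> R[i]) H :
  (forall n, measurable_cfun D (G n)) ->
  (forall p, D p -> (fun n => G n p) @ \oo --> H p) -> measurable_cfun D H.
Proof.
move=> mG GH; split.
  apply: (measurable_fun_cvg (h := fun n p => complex.Re (G n p))).
    by move=> n; exact: (mG n).1.
  move=> p Dp; apply/subr_cvg0/norm_cvg0P.
  have /cvg_normc GHp := GH p Dp.
  apply: squeeze_cvgr GHp; last exact: cvg_cst.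
  near=> n; rewrite normr_ge0/=.
  by have := normc_ge_absRe (G n p - H p); case: (G n p); case: (H p).
apply: (measurable_fun_cvg (h := fun n p => complex.Im (G n p))).
  by move=> n; exact: (mG n).2.
move=> p Dp; apply/subr_cvg0/norm_cvg0P.
have /cvg_normc GHp := GH p Dp.
apply: squeeze_cvgr GHp; last exact: cvg_cst.
near=> n; rewrite normr_ge0/=.
by have := normc_ge_absIm (G n p - H p); case: (G n p); case: (H p).
Unshelve. all: by end_near. Qed.

Lemma measurable_sqr_normc D G : measurable_cfun D G ->
  measurable_fun D (fun p => normc (G p) ^+ 2).
Proof.
move=> [G1 G2]; under [X in measurable_fun _ X]eq_fun do rewrite sqr_normc_ReIm.
by apply: measurable_funD; exact: measurable_funX.
Qed.

Definition pdisk : set plane := [set p | disk (cplane p)].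

Lemma measurable_pdisk : measurable pdisk.
Proof.
rewrite (_ : pdisk = [set p | normc (cplane p) ^+ 2 < 1]); last first.
  apply/seteqP; split => p /=; rewrite /pdisk/= /disk/=.
    by move=> h; rewrite expr_lt1// normc_ge0.
  by rewrite expr_lt1// normc_ge0.
have /(_ measurableT `]-oo, 1[%classic (measurable_itv _)) :=
  measurable_sqr_normc (measurable_cfun_cplane setT).
by rewrite setTI; congr measurable.
Qed.

Lemma measurable_cfun_taylor F b : taylor_on_disk F b ->
  measurable_cfun pdisk (fun p => F (cplane p)).
Proof.
move=> Fb; apply: (measurable_cfun_cvg (G := fun n p => series (fun j => b j * cplane
  p ^+ j) n)).
  elim=> [|n IH].
    rewrite /series/=; under [X in measurable_cfun _ X]eq_fun do rewrite big_geq//.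
    exact: measurable_cfun_cst.
  rewrite /series/=; under [X in measurable_cfun _ X]eq_fun do rewrite big_nat_recr//=.
  apply: measurable_cfunD => //; apply: measurable_cfunM; first exact:
    measurable_cfun_cst.
  exact/measurable_cfunX/measurable_cfun_cplane.
by move=> p; exact: Fb.
Qed.

Lemma integral_rotate w (f : plane -> \bar R) : normc w = 1 -> w != -1 ->
  measurable_fun pdisk f -> (forall p, pdisk p -> 0 <= f p)%E ->
  (\int[mu2]_(p in pdisk) f (rotate w p) = \int[mu2]_(p in pdisk) f p)%E.
Proof.
move=> w1 wN1 mf f0.
have E : rotate w @^-1` pdisk = pdisk.
  apply/funext => p; rewrite -[LHS]/(is_true (normc (cplane (rotate w p)) < 1)).
  by rewrite cplane_rotate normcM w1 mul1r.
have := area_preserving_integral (area_preserving_rotate w1 wN1) measurable_pdisk mf f0.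
by rewrite E.
Qed.
End rotations.

(** * Coefficients of a function in a weighted Bergman space *)

Section bergman.
Variable R : realType.
Local Notation mu := (@lebesgue_measure R).
Local Notation mu2 := (@lebesgue_measure R \x @lebesgue_measure R)%E.
Local Notation plane := (measurableTypeR R * measurableTypeR R)%type.

Definition sqmod (p : plane) : R := normc (cplane p) ^+ 2.

Lemma sqmodE (p : plane) : sqmod p = p.1 ^+ 2 + p.2 ^+ 2.
Proof. by rewrite /sqmod sqr_normc_ReIm. Qed.

Lemma sqmod_ge0 p : 0 <= sqmod p.
Proof. exact: sqr_ge0. Qed.

Lemma measurable_sqmod D : measurable_fun D sqmod.
Proof. exact: (measurable_sqr_normc (measurable_cfun_cplane D)). Qed.

Lemma measurable_sqmod_itv (i : interval R) : measurable [set p | sqmod p \in i].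
Proof.
have /(_ measurableT [set` i] (measurable_itv _)) := @measurable_sqmod setT.
by rewrite setTI.
Qed.

Lemma pdisk_sqmod p : pdisk p <-> sqmod p < 1.
Proof. by rewrite /pdisk/= /disk/= /sqmod expr_lt1// normc_ge0. Qed.

(** Over each [x] in [[0, 1/2]] the annulus contains the segment from [u = sqrt (a - x^2)] to
    [v = sqrt (b - x^2)], of length [(b - a) / (u + v) >= (b - a) / 2] since [u, v <= 1];
    integration over [x] halves this. *)
Lemma annulus_measure_ge (a b : R) : 1 / 2 <= a -> a <= b -> b <= 1 ->
  (((b - a) / 4)%:E <= mu2 [set p | sqmod p \in `[a, b]])%E.
Proof.
move=> a12 ab b1; set A := [set p | _].
have mA : measurable A by exact: measurable_sqmod_itv.
rewrite /product_measure1.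
have mx := measurable_fun_xsection mu mA.
apply: (@le_trans _ _ (\int[mu]_(x in `[0%R, (1 / 2)%R]) (mu \o xsection A) x)%E);
  last first.
  by apply: ge0_subset_integral => //.
apply: (@le_trans _ _ (\int[mu]_(x in `[0%R, (1 / 2)%R]) (cst ((b - a) / 2)%R%:E x))%E).
  rewrite integral_cst//= lebesgue_measure_itv/= lte_fin ifT; last by lra.
  by rewrite -EFinB -EFinM lee_fin; lra.
apply: ge0_le_integral => //.
- by move=> x _; rewrite lee_fin; lra.
- exact: measurable_funTS.
move=> x /=; rewrite in_itv/= => /andP[x0 x12].
have ax : 0 <= a - x ^+ 2 by nra.
have bx : 0 <= b - x ^+ 2 by nra.
pose u := Num.sqrt (a - x ^+ 2); pose v := Num.sqrt (b - x ^+ 2).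
have u2 : u ^+ 2 = a - x ^+ 2 by rewrite sqr_sqrtr.
have v2 : v ^+ 2 = b - x ^+ 2 by rewrite sqr_sqrtr.
have u0 : 0 <= u by exact: sqrtr_ge0.
have v0 : 0 <= v by exact: sqrtr_ge0.
have uv : u <= v by rewrite ler_wsqrtr// lerD2r.
have v1 : v <= 1 by nra.
apply: (@le_trans _ _ (mu `[u, v]%classic)).
  rewrite lebesgue_measure_itv/= lte_fin; case: ltP => uv'.
    rewrite -EFinB lee_fin; nra.
  have -> : a = b by have := le_anti; nra.
  by rewrite subrr mul0r.
apply: le_measure; rewrite ?inE//; first exact: measurable_xsection.
move=> y /=; rewrite in_itv/= => /andP[uy yv].
rewrite /xsection/= inE /A/= sqmodE/= in_itv/=; apply/andP; split; nra.
Qed.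

(* With [h = 1 / (4 n)], the annulus [1 - 2 h <= |z|^2 <= 1 - h] has area at
   least [h / 4], and there [1 - |z|^2 >= h] and [|z|^(2 r) >= 1 / 2] by
   Bernoulli's inequality. *)
Lemma monomial_weight_ge (r : nat) (B : set plane) (n := r.+1%:R : R) : measurable B ->
  B `<=` @pdisk R ->
  (forall p, sqmod p <= 1 - (4 * n)^-1 -> B p) ->
  (((128 * n ^+ 2)^-1)%:E <= \int[mu2]_(p in B) (sqmod p ^+ r * (1 - sqmod p))%:E)%E.
Proof.
move=> mB BD hB.
have n1 : 1 <= n by rewrite ler1n.
pose h := (4 * n)^-1; have hn : h * n = 1 / 4 by rewrite /h; field; lra.
have h0 : 0 < h by rewrite invr_gt0; lra.
have h14 : h <= 1 / 4 by nra.
pose A := [set p : plane | sqmod p \in `[1 - 2 * h, 1 - h]].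
have mA : measurable A by exact: measurable_sqmod_itv.
have AB : A `<=` B.
  by move=> p; rewrite /A/= in_itv/= => /andP[_ ph]; exact: hB.
have mf D : measurable_fun D (fun p => (sqmod p ^+ r * (1 - sqmod p))%:E).
  apply/measurable_EFinP/measurable_funM; first by apply: measurable_funX; exact:
    (@measurable_sqmod D).
  by apply: measurable_funB; [exact: measurable_cst|exact: (@measurable_sqmod D)].
have f0 p : B p -> (0 <= (sqmod p ^+ r * (1 - sqmod p))%:E)%E.
  move=> /BD/pdisk_sqmod p1; rewrite lee_fin; apply: mulr_ge0.
    by apply: exprn_ge0; exact: sqmod_ge0.
  by rewrite subr_ge0 ltW.
apply: (@le_trans _ _ (\int[mu2]_(p in A) (sqmod p ^+ r * (1 - sqmod p))%:E)%E); last
  first.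
  exact: ge0_subset_integral.
apply: (@le_trans _ _ (\int[mu2]_(p in A) (cst (h / 2)%:E p))%E).
  rewrite integral_cst//.
  apply: (@le_trans _ _ ((h / 2)%:E * (h / 4)%:E)%E).
    (* The integrand is at least [h / 2] on an annulus of area at least [h / 4]. *)
    have -> : (128 * n ^+ 2)^-1 = h ^+ 2 / 8 by rewrite /h; field; lra.
    by rewrite -EFinM lee_fin; lra.
  apply: lee_wpmul2l; first by rewrite lee_fin; lra.
  have a1 : 1 / 2 <= 1 - 2 * h by lra.
  have a2 : 1 - 2 * h <= 1 - h by lra.
  have a3 : 1 - h <= 1 by lra.
  apply: le_trans (annulus_measure_ge a1 a2 a3).
  by rewrite lee_fin; lra.
apply: ge0_le_integral => //.
- by move=> p _; rewrite lee_fin; lra.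
move=> p; rewrite /A/= in_itv/= => /andP[p1 p2]; rewrite lee_fin.
have bern k (x : R) : 0 <= x -> x <= 1 -> 1 - k%:R * x <= (1 - x) ^+ k.
  move=> x0 x1; elim: k => [|k IH]; first by rewrite expr0; lra.
  rewrite exprS -natr1; apply: (@le_trans _ _ ((1 - x) * (1 - k%:R * x))).
    have : (0 : R) <= k%:R by []. nra.
  by apply: ler_wpM2l => //; lra.
have pr : 1 / 2 <= sqmod p ^+ r.
  apply: (@le_trans _ _ ((1 - 2 * h) ^+ r)); last first.
    by apply: lerXn2r => //; rewrite nnegrE; lra.
  have h1 : 0 <= 2 * h by lra.
  have h2 : 2 * h <= 1 by lra.
  apply: (le_trans _ (bern r (2 * h) h1 h2)).
  have : n = r%:R + 1 by rewrite natr1.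
  have : (0 : R) <= r%:R by []. nra.
have : (1 / 2) * h <= sqmod p ^+ r * (1 - sqmod p) by apply: ler_pM => //; lra.
lra.
Qed.
End bergman.

Section bergman_coefficients.
Variable R : realType.
Local Notation mu := (@lebesgue_measure R).
Local Notation mu2 := (@lebesgue_measure R \x @lebesgue_measure R)%E.
Local Notation plane := (measurableTypeR R * measurableTypeR R)%type.
Implicit Types (F : R[i] -> R[i]) (b : nat -> R[i]).

(* The mean of [|F|^2] over the rotates of [z] by the [N]-th roots of unity is,
   by Parseval on the cyclic group, that of its Taylor polynomial up to a tail
   which is uniformly small on [|z| <= rho]. *)
Lemma circle_mean_ge F b (rho e : R) : taylor_on_disk F b -> 0 <= rho ->
  rho < 1 -> 0 < e -> exists N0, forall N (w z : R[i]), (N0 <= N)%N ->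
  N.-primitive_root w -> normc z <= rho ->
  \sum_(j < N) normc (b j * z ^+ j) ^+ 2 <=
  \sum_(l < N) N%:R^-1 * normc (F (w ^+ l * z)) ^+ 2 + e.
Proof.
move=> Fb rho0 rho1 e0.
have sb := taylor_disk_summable Fb rho0 rho1.
have b0 j : 0 <= normc (b j) * rho ^+ j by rewrite mulr_ge0 ?normc_ge0 ?exprn_ge0.
have [K hK] := sb.
have K0 : 0 <= K by have := hK 0%N; rewrite big_geq.
(* With [P] the partial sum, [|P| <= |F| + t] and [|P| <= K] give [|P|^2 - |F|^2 <= 2 K t <= e]. *)
pose t := Num.min 1 (e / (2 * K + 1)).
have t0 : 0 < t by rewrite lt_min ltr01 divr_gt0//; lra.
have t1 : t <= 1 by rewrite ge_min lexx.
have te : t * (2 * K + 1) <= e.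
  rewrite -ler_pdivlMr; last by lra.
  by rewrite ge_min lexx orbT.
have [N0 hN0] := sum_bounded_tail b0 sb t0.
exists N0 => N w z NN pw zr.
have N0' : 0 < N%:R :> R by rewrite ltr0n (prim_order_gt0 pw).
have dom (u : R[i]) j : normc u <= rho -> normc (b j) * normc u ^+ j <= normc (b j) *
  rho ^+ j.
  move=> ur; apply: ler_wpM2l; first exact: normc_ge0.
  by apply: lerXn2r => //; rewrite nnegrE// normc_ge0.
have key (l : 'I_N) : normc (\sum_(j < N) (b j * z ^+ j) * (w ^+ l) ^+ j) ^+ 2 <=
    normc (F (w ^+ l * z)) ^+ 2 + e.
  have -> : \sum_(j < N) (b j * z ^+ j) * (w ^+ l) ^+ j =
      \sum_(0 <= j < N) b j * (w ^+ l * z) ^+ j.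
    by rewrite big_mkord; apply: eq_bigr => j _; rewrite exprMn; ring.
  set u := w ^+ l * z.
  have ur : normc u <= rho by rewrite /u normcM normcX (normc_prim_root pw) expr1n mul1r.
  have du : disk u by rewrite /disk/=; exact: le_lt_trans ur rho1.
  have tl : normc (F u - \sum_(0 <= j < N) b j * u ^+ j) <= t.
    apply: (taylor_tail Fb du) => m; apply: le_trans (hN0 m).
    apply: (@le_trans _ _ (\sum_(N <= j < m) normc (b j) * rho ^+ j)).
      by apply: ler_sum => j _; exact: dom.
    case: (leqP N m) => Nm; last first.
      by rewrite big_geq ?(ltnW Nm)// sumr_ge0.
    by rewrite [leRHS](big_cat_nat (n := N))//= lerDr sumr_ge0.
  have pK : normc (\sum_(0 <= j < N) b j * u ^+ j) <= K.
    apply: le_trans (hK N); apply: le_trans (normc_sum _ _ _) _.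
    by apply: ler_sum => j _; rewrite normcM normcX; exact: dom.
  move: tl pK; set P := \sum_(0 <= j < N) _ => tl pK.
  have := ler_normcB P (F u); rewrite (normcBC P) => pf.
  have := normc_ge0 P; have := normc_ge0 (F u).
  by case: (leP (normc P) (normc (F u))); nra.
have H : \sum_(l < N) normc (\sum_(j < N) (b j * z ^+ j) * (w ^+ l) ^+ j) ^+ 2 <=
    \sum_(l < N) (normc (F (w ^+ l * z)) ^+ 2 + e).
  by apply: ler_sum => l _; exact: key.
move: H; rewrite (prim_root_parseval (fun j => b j * z ^+ j) pw) big_split/=.
rewrite sumr_const card_ord -mulr_sumr -[e *+ N]mulr_natl => H.
by rewrite -(ler_pM2l N0') mulrDr mulrA divff ?gt_eqF// mul1r.
Qed.

Lemma taylor_rotate F b (u : R[i]) : normc u = 1 -> taylor_on_disk F b ->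
  taylor_on_disk (fun z => F (u * z)) (fun j => b j * u ^+ j).
Proof.
move=> u1 Fb z dz.
have -> : (fun j => b j * u ^+ j * z ^+ j) = (fun j => b j * (u * z) ^+ j).
  by apply/funext => j; rewrite exprMn mulrA.
by apply: Fb; rewrite /disk/= normcM u1 mul1r.
Qed.

Definition bergman_density F (p : plane) : R :=
  normc (F (cplane p)) ^+ 2 * (1 - sqmod p).

Lemma measurable_bergman_density F b : taylor_on_disk F b ->
  measurable_fun (@pdisk R) (fun p => (bergman_density F p)%:E).
Proof.
move=> Fb; apply/measurable_EFinP/measurable_funM.
  exact: measurable_sqr_normc (measurable_cfun_taylor Fb).
by apply: measurable_funB; [exact: measurable_cst|exact: measurable_sqmod].
Qed.

Lemma bergman_density_ge0 F p : @pdisk R p -> 0 <= bergman_density F p.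
Proof.
move=> /pdisk_sqmod p1; apply: mulr_ge0; first exact: sqr_ge0.
by rewrite subr_ge0 ltW.
Qed.

(** Powers of [w] are reached one rotation at a time, because [w ^+ l] itself may be the excluded
    half turn. *)
Lemma integral_bergman_rotate F b (w : R[i]) l : taylor_on_disk F b ->
  normc w = 1 -> w != -1 ->
  (\int[mu2]_(p in @pdisk R) (bergman_density (fun z => F (w ^+ l * z)%R) p)%:E =
   \int[mu2]_(p in @pdisk R) (bergman_density F p)%:E)%E.
Proof.
move=> Fb w1 wN1; elim: l => [|l IH].
  by apply: eq_integral => p _; rewrite /bergman_density expr0 mul1r.
rewrite -IH.
have wl1 : normc (w ^+ l) = 1 by rewrite normcX w1 expr1n.
have Fl := taylor_rotate wl1 Fb.
have h0 p : @pdisk R p -> (0 <= (bergman_density (fun z => F (w ^+ l * z)%R) p)%:E)%E.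
  by move=> dp; rewrite lee_fin bergman_density_ge0.
rewrite -(integral_rotate w1 wN1 (measurable_bergman_density Fl) h0).
apply: eq_integral => p _; congr EFin; rewrite /bergman_density /sqmod cplane_rotate.
by rewrite normcM w1 mul1r mulrA -exprSr.
Qed.

Lemma measure_subdisk_le (B : set plane) : measurable B -> B `<=` @pdisk R ->
  (mu2 B <= 4%:E)%E.
Proof.
move=> mB BD.
pose I : set (measurableTypeR R) := [set` `[-1, 1]%R].
have mI : measurable I by exact: measurable_itv.
have I2 : mu I = 2%:E.
  transitivity (mu `[(-1), 1]%classic) => //.
  by rewrite lebesgue_measure_itv/= lte_fin ifT -?EFinB; [congr EFin|]; lra.
have E : mu2 (I `*` I) = 4%:E.
  rewrite product_measure1E//; move: I2 => /= ->.
  by rewrite -EFinM; congr EFin; lra.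
rewrite -E; apply: le_measure; rewrite ?inE//; first exact: measurableX.
move=> p /BD/pdisk_sqmod; rewrite sqmodE => p1.
have := sqr_ge0 p.1; have := sqr_ge0 p.2 => h1 h2.
by split; rewrite /I/= in_itv/=; apply/andP; split; nra.
Qed.

(** For each [M] the circular mean inequality is integrated over a smaller disk [B]. On the left
    each [|b r|^2] is multiplied by an integral of at least [1 / (128 (r + 1)^2)]; on the right each
    of the [N] rotated integrals is at most [i], and the error is [e] times the area of [B]. The
    resulting bound [128 i] does not depend on [M]. *)
Lemma bergman_coef F b : taylor_on_disk F b ->
  (\int[mu2]_(p in @pdisk R) (bergman_density F p)%:E < +oo)%E ->
  sum_bounded (fun r => (normc (b r) / r.+1%:R) ^+ 2).
Proof.
move=> Fb; set I := (integral _ _ _) => Ioo.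
have I0 : (0 <= I)%E by apply: integral_ge0 => p dp; rewrite lee_fin bergman_density_ge0.
have finI : I \is a fin_num by rewrite ge0_fin_numE.
have i0 := fine_ge0 I0; clear Ioo I0; set i := fine I in i0.
exists (128 * i) => -[|M]; first by rewrite big_geq// mulr_ge0.
(* The disk [|z|^2 <= 1 - h] then contains the annuli that serve for all degrees [r <= M] at once,
   yet stays inside a radius [rho < 1], where the Taylor tails are uniformly small. *)
pose h : R := (4 * M.+1%:R)^-1.
have M1 : 1 <= M.+1%:R :> R by rewrite ler1n.
have h0 : 0 < h by rewrite invr_gt0; lra.
have h1 : h <= 1 / 4.
  have : h * M.+1%:R = 1 / 4 by rewrite /h; field; lra.
  by nra.
pose B := [set p : plane | sqmod p \in `]-oo, 1 - h]].
have mB : measurable B by exact: measurable_sqmod_itv.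
have BD : B `<=` @pdisk R.
  by move=> p; rewrite /B/= in_itv/= => ph; apply/pdisk_sqmod; lra.
pose rho := Num.sqrt (1 - h).
have rho2 : rho ^+ 2 = 1 - h by rewrite sqr_sqrtr//; lra.
have rho0 : 0 <= rho by exact: sqrtr_ge0.
have rho1 : rho < 1 by nra.
have Brho p : B p -> normc (cplane p) <= rho.
  rewrite /B/= in_itv/= -rho2 /sqmod => H.
  by rewrite -(ler_pXn2r (n := 2))// nnegrE// normc_ge0.
have mmono r : measurable_fun B (fun p => sqmod p ^+ r * (1 - sqmod p)).
  apply: measurable_funM; first by apply: measurable_funX; exact: (@measurable_sqmod R B).
  by apply: measurable_funB; [exact: measurable_cst|exact: (@measurable_sqmod R B)].
have mono0 r p : B p -> 0 <= sqmod p ^+ r * (1 - sqmod p).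
  move=> /BD/pdisk_sqmod p1; apply: mulr_ge0; first by apply: exprn_ge0; exact: sqmod_ge0.
  by rewrite subr_ge0 ltW.
have low : ((\sum_(r < M.+1) (normc (b r) / r.+1%:R) ^+ 2 / 128)%:E <=
    \int[mu2]_(p in B) (\sum_(r < M.+1) (normc (b r) ^+ 2 * (sqmod p ^+ r * (1 -
      sqmod p)))%:E))%E.
  rewrite ge0_integral_sum//; last 2 first.
  - by move=> r; apply/measurable_EFinP/measurable_funM => //; exact: measurable_cst.
  - by move=> r p Bp; rewrite lee_fin; apply: mulr_ge0; [exact: sqr_ge0|exact: mono0].
  rewrite -sumEFin; apply: lee_sum => r _.
  under eq_integral do rewrite EFinM.
  rewrite ge0_integralZl_EFin//; last 3 first.
  - by move=> p Bp; rewrite lee_fin; exact: mono0.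
  - exact/measurable_EFinP.
  - exact: sqr_ge0.
  apply: (@le_trans _ _ ((normc (b r) ^+ 2)%:E * ((128 * r.+1%:R ^+ 2)^-1)%:E)%E).
    have r0 : r.+1%:R != 0 :> R by rewrite pnatr_eq0.
    rewrite -EFinM lee_fin le_eqVlt; apply/orP; left; apply/eqP.
    by move: (r.+1%:R : R) r0 => x x0; field.
  apply: lee_wpmul2l; first by rewrite lee_fin sqr_ge0.
  apply: monomial_weight_ge => // p pr; rewrite /B/= in_itv/=.
  apply: (le_trans pr); rewrite lerD2l lerN2 /h.
  rewrite lef_pV2 ?posrE; [|by rewrite mulr_gt0 ?ltr0n|by rewrite mulr_gt0 ?ltr0n].
  by rewrite ler_pM2l// ler_nat.
suff up e : 0 < e -> \sum_(r < M.+1) (normc (b r) / r.+1%:R) ^+ 2 / 128 <= i + e * 4.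
  rewrite big_mkord mulrC -ler_pdivrMr// mulr_suml.
  apply/ler_addgt0Pr => e e0.
  have e4 : 0 < e / 4 by rewrite divr_gt0.
  by rewrite (le_trans (up _ e4))// divfK.
move=> e0.
have [N0 hN0] := circle_mean_ge Fb rho0 rho1 e0.
(* [N0] makes the tail small, [M.+1] keeps the degrees up to [M] in the Parseval sum, and 3 excludes
   [w = -1]. *)
pose N := maxn N0 (maxn M.+1 3).
have NN0 : (N0 <= N)%N by rewrite leq_maxl.
have NM : (M.+1 <= N)%N by rewrite /N !leq_max leqnn orbT.
have N3 : (2 < N)%N by rewrite /N !leq_max leqnn !orbT.
have N00 : (0 < N)%N by exact: ltnW (ltnW N3).
have [w pw] := @prim_root_exists_closed R[i] N N00.
have w1 := normc_prim_root pw.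
have wN1 := prim_root_neqN1 pw N3.
rewrite -lee_fin; apply: (le_trans low); clear low.
pose H l p := bergman_density (fun z => F (w ^+ l * z)) p.
have TH l : taylor_on_disk (fun z => F (w ^+ l * z)) (fun j => b j * (w ^+ l) ^+ j).
  by apply: taylor_rotate => //; rewrite normcX w1 expr1n.
have mH l : measurable_fun B (fun p => (H l p)%:E).
  exact: measurable_funS (@measurable_pdisk R) BD (measurable_bergman_density (TH l)).
have H0 l p : B p -> 0 <= H l p by move=> /BD; exact: bergman_density_ge0.
have N1 : 0 <= N%:R^-1 :> R by rewrite invr_ge0.
apply: (@le_trans _ _ (\int[mu2]_(p in B)
    (\sum_(l < N) (N%:R^-1 * H l p)%:E + e%:E))%E).
  apply: ge0_le_integral => //.
  - move=> p Bp; apply: sume_ge0 => r _; rewrite lee_fin.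
    by apply: mulr_ge0; [exact: sqr_ge0|exact: mono0].
  - apply: emeasurable_sum => r; apply/measurable_EFinP/measurable_funM => //; exact:
    measurable_cst.
  - apply: emeasurable_funD; last exact: measurable_cst.
    apply: emeasurable_sum => l; apply/measurable_EFinP/measurable_funM; first exact:
      measurable_cst.
    by apply/measurable_EFinP; exact: mH.
  move=> p Bp; rewrite !sumEFin -EFinD lee_fin.
  have Hp := hN0 N w (cplane p) NN0 pw (Brho p Bp).
  have p1 : 0 <= 1 - sqmod p by rewrite subr_ge0 ltW//; apply/pdisk_sqmod/BD.
  have p2 := sqmod_ge0 p.
  apply: (@le_trans _ _ ((\sum_(j < N) normc (b j * cplane p ^+ j) ^+ 2) * (1 - sqmod
    p))).
    rewrite mulr_suml.
    pose f j := normc (b j * cplane p ^+ j) ^+ 2 * (1 - sqmod p).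
    have f0 j : 0 <= f j by rewrite mulr_ge0// sqr_ge0.
    rewrite -(big_mkord xpredT f) (big_cat_nat (n := M.+1))//= big_mkord.
    apply: (@le_trans _ _ (\sum_(j < M.+1) f j)); last by rewrite lerDl sumr_ge0.
    apply: ler_sum => j _; rewrite /f.
    have -> : normc (b j * cplane p ^+ j) ^+ 2 = normc (b j) ^+ 2 * sqmod p ^+ j.
      by rewrite normcM normcX exprMn /sqmod -!exprM mulnC.
    by rewrite mulrA.
  apply: (@le_trans _ _ ((\sum_(l < N) N%:R^-1 * normc (F (w ^+ l * cplane p)) ^+ 2 +
    e) * (1 - sqmod p))).
    exact: ler_wpM2r.
  rewrite mulrDl mulr_suml; apply: lerD.
    by apply: ler_sum => l _; rewrite -mulrA.
  by rewrite -[leRHS]mulr1; apply: ler_wpM2l; lra.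
rewrite ge0_integralD//; last 3 first.
- by move=> p Bp; apply: sume_ge0 => l _; rewrite lee_fin mulr_ge0// H0.
- apply: emeasurable_sum => l; apply/measurable_EFinP/measurable_funM; first exact:
  measurable_cst.
  by apply/measurable_EFinP; exact: mH.
- by move=> p _; rewrite lee_fin ltW.
rewrite EFinD; apply: leeD; last first.
  rewrite integral_cst// EFinM; apply: lee_wpmul2l; first by rewrite lee_fin ltW.
  exact: measure_subdisk_le.
rewrite ge0_integral_sum//; last 2 first.
- move=> l; apply/measurable_EFinP/measurable_funM; first exact: measurable_cst.
  by apply/measurable_EFinP; exact: mH.
- by move=> l p Bp; rewrite lee_fin mulr_ge0// H0.
apply: (@le_trans _ _ (\sum_(l < N) (N%:R^-1 * i)%:E)%E); last first.
  rewrite sumEFin lee_fin sumr_const card_ord -[leLHS]mulr_natl mulrA divff ?mul1r//.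
  by rewrite pnatr_eq0 -lt0n.
apply: lee_sum => l _; under eq_integral do rewrite EFinM.
rewrite ge0_integralZl_EFin//; last by move=> p Bp; rewrite lee_fin H0.
rewrite EFinM; apply: lee_wpmul2l; first by rewrite lee_fin.
rewrite /i fineK// /I -(integral_bergman_rotate l Fb w1 wN1).
apply: ge0_subset_integral => //; first exact: measurable_pdisk.
  exact: measurable_bergman_density (TH l).
by move=> p dp; rewrite lee_fin bergman_density_ge0.
Qed.
End bergman_coefficients.

(** * Hardy's inequality and the representation at one point *)

Section hardy.
Variable R : realType.

(** Hardy's inequality in its dual form, on tails, with constant 4. Summation by parts bounds the
    sum of [S j ^+ 2] by that of [2 * v j * S j], and [2 v S <= 2 v^2 + S^2 / 2] lets half of the
    left side be absorbed. *)
Lemma hardy_tail (v : nat -> R) (M : nat) : (forall r, 0 <= v r) ->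
  \sum_(j < M) (\sum_(j <= r < M) v r / r.+1%:R) ^+ 2 <= 4 * \sum_(r < M) v r ^+ 2.
Proof.
move=> v0; pose S j := \sum_(j <= r < M) v r / r.+1%:R.
have S0 j : 0 <= S j by rewrite sumr_ge0// => r _; rewrite divr_ge0.
have Srec k : (k < M)%N -> S k = v k / k.+1%:R + S k.+1.
  by move=> kM; rewrite /S big_ltn.
(* Abel summation, with [v k = (k + 1) * (S k - S k.+1)] *)
have key k : (k <= M)%N -> \sum_(j < k) S j ^+ 2 - k%:R * S k ^+ 2 <=
    \sum_(j < k) (2 * v j ^+ 2 + S j ^+ 2 / 2).
  elim: k => [|k IH] kM; first by rewrite !big_ord0 mul0r subrr.
  rewrite !big_ord_recr/=; have := IH (ltnW kM).
  have n0 : 0 < k.+1%:R :> R by rewrite ltr0n.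
  have Ek := Srec k kM; have vk : v k = k.+1%:R * (S k - S k.+1).
    by rewrite Ek; field; rewrite gt_eqF.
  have h1 : k.+1%:R * (S k ^+ 2 - S k.+1 ^+ 2) = v k * (S k + S k.+1).
    by rewrite vk; ring.
  have h2 : S k.+1 <= S k by rewrite Ek lerDr divr_ge0.
  have h3 := sqr_ge0 (2 * v k - S k).
  have h4 : v k * S k.+1 <= v k * S k by apply: ler_wpM2l.
  rewrite -natr1 in h1 *.
  lra.
have := key M (leqnn M); rewrite {2}/S big_geq// expr0n mulr0 subr0.
rewrite big_split/= -mulr_sumr -mulr_suml -/(S _).
lra.
Qed.
End hardy.

(** * Division by one linear factor *)

Section one_point.
Variable R : realType.
Implicit Types (f : R[i] -> R[i]) (a : nat -> R[i]).

Lemma cvg_sum_ord (K : nat) (u : nat -> nat -> R) (l : nat -> R) :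
  (forall j, (fun n => u n j) @ \oo --> l j) ->
  (fun n => \sum_(j < K) u n j) @ \oo --> \sum_(j < K) l j.
Proof.
move=> ul; elim: K => [|K IH].
  by rewrite big_ord0; under eq_fun do rewrite big_ord0; exact: cvg_cst.
rewrite big_ord_recr/=; under eq_fun do rewrite big_ord_recr/=.
exact: cvgD.
Qed.

(** The term [j = 0] of Hardy's inequality bounds the partial sums of [|y r|], so [Y] exists. The
    remainder at [j] is dominated by the tail at [j]; the square sum is bounded for tails cut at a
    finite [M], and then [M] tends to infinity. *)
Lemma hardy_remainder (y : nat -> R[i]) (v : nat -> R) : (forall r, 0 <= v r) ->
  sum_bounded (fun r => v r ^+ 2) -> (forall r, normc (y r) <= v r / r.+1%:R) ->
  exists Y : R[i], sum_bounded (fun j => normc (Y - \sum_(0 <= r < j) y r) ^+ 2).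
Proof.
move=> v0 [V hV] yv.
have V0 : 0 <= V by have := hV 0%N; rewrite big_geq.
have hardy M : \sum_(j < M) (\sum_(j <= r < M) v r / r.+1%:R) ^+ 2 <= 4 * V.
  by apply: le_trans (hardy_tail M v0) _; apply: ler_wpM2l => //; rewrite -(big_mkord
    xpredT (fun r => v r ^+ 2)).
have [Y hY] : exists Y : R[i], series y @ \oo --> Y.
  apply: cvgc_series; apply: sum_bounded_le yv _; exists (Num.sqrt (4 * V)) => -[|M].
    by rewrite big_geq// sqrtr_ge0.
  have s0 : 0 <= \sum_(0 <= r < M.+1) v r / r.+1%:R by rewrite sumr_ge0// => r _;
    rewrite divr_ge0.
  rewrite -(ger0_norm s0) -sqrtr_sqr ler_wsqrtr//.
  apply: le_trans (hardy M.+1); rewrite big_ord_recl/= lerDl.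
  by rewrite sumr_ge0// => j _; exact: sqr_ge0.
exists Y; exists (4 * V) => N; rewrite big_mkord.
have cN : (fun M => \sum_(j < N) normc (series y M - \sum_(0 <= r < j) y r) ^+ 2) @
  \oo -->
    \sum_(j < N) normc (Y - \sum_(0 <= r < j) y r) ^+ 2.
  apply: (@cvg_sum_ord N (fun M j => normc (series y M - \sum_(0 <= r < j) y r) ^+ 2)
    (fun j => normc (Y - \sum_(0 <= r < j) y r) ^+ 2)) => j.
  have h : normc (series y M - \sum_(0 <= r < j) y r) @[M --> \oo] --> normc (Y -
    \sum_(0 <= r < j) y r).
    exact: cvg_normc_of (cvgc_sub hY (cvgc_cst _)).
  exact: (cvgM h h).
rewrite -(cvg_lim _ cN)//; apply: limr_le; first by apply/cvg_ex; eexists; exact: cN.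
exists N => // M /= NM; apply: le_trans (hardy M).
have E j : (j < N)%N -> normc (series y M - \sum_(0 <= r < j) y r) <= \sum_(j <= r <
  M) v r / r.+1%:R.
  move=> jN; have jM : (j <= M)%N by exact: leq_trans (ltnW jN) NM.
  rewrite /series/= (big_cat_nat (n := j))//= addrAC subrr add0r.
  by apply: le_trans (normc_sum _ _ _) _; apply: ler_sum => r _; exact: yv.
apply: (@le_trans _ _ (\sum_(j < N) (\sum_(j <= r < M) v r / r.+1%:R) ^+ 2)).
  apply: ler_sum => j _; apply: lerXn2r; rewrite ?nnegrE ?normc_ge0 ?E//.
  by rewrite sumr_ge0// => r _; rewrite divr_ge0.
rewrite -!(big_mkord xpredT (fun j => (\sum_(j <= r < M) v r / r.+1%:R) ^+ 2)).
by rewrite [leRHS](big_cat_nat (n := N))//= lerDl sumr_ge0// => j _; exact: sqr_ge0.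
Qed.

Definition H2_seq a := sum_bounded (fun j => normc (a j) ^+ 2).

Lemma H2_seq_disk_summable a : H2_seq a -> disk_summable a.
Proof.
move=> ha; apply/disk_summableP.
have [|M M0 hM] := sum_bounded_ge _ ha; first by move=> j; exact: sqr_ge0.
apply: (@bounded_disk_bounded _ a (M + 1)) => [|j]; first by lra.
by have := hM j; have := normc_ge0 (a j); nra.
Qed.

Lemma H2P g : H2 g <-> exists2 a, taylor_on_disk g a & H2_seq a.
Proof.
by split=> -[a ga ha]; exists a => //; apply/sum_boundedP => // j; exact: sqr_ge0.
Qed.

(* Up to the unimodular factor [zeta^(m+1)], [weighted_sum zeta a m.+1] is the
   coefficient of degree [m] of [f'(z) / (1 - z / zeta)], where [f] has
   coefficients [a]. *)
Definition weighted_sum (zeta : R[i]) a (m : nat) : R[i] :=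
  \sum_(k < m) k.+1%:R * a k.+1 * zeta ^+ k.+1.

(** The relation is [f = alpha + (z - zeta) g] read in degrees at least 1. Its solution tending to 0
    is [g j = zeta^(-j-1) sum_(k > j) a k zeta^k]. *)
Lemma one_point_coefs (zeta : R[i]) a : normc zeta = 1 ->
  sum_bounded (fun r => (normc (weighted_sum zeta a r.+1) / r.+1%:R) ^+ 2) ->
  exists2 g, H2_seq g & forall j, a j.+1 = g j - zeta * g j.+1.
Proof.
move=> z1 hT; pose T := weighted_sum zeta a.
pose v r := normc (T r.+1) / r.+1%:R.
have v0 r : 0 <= v r by rewrite divr_ge0// normc_ge0.
have nat0 n : (n.+1%:R : R[i]) != 0 by rewrite pnatr_eq0.
(* From [a k * zeta ^+ k = (T k - T (k - 1)) / k] and [1 / (r + 1) - 1 / (r + 2) = 1 / ((r + 1) (r +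
   2))]. *)
pose y r := T r.+1 / (r.+1%:R * r.+2%:R).
have yv r : normc (y r) <= v r / r.+1%:R.
  rewrite /y /v normcM normcV normcM !normc_nat -mulrA -invfM.
  apply: ler_wpM2l; first exact: normc_ge0.
  rewrite lef_pV2 ?posrE ?mulr_gt0 ?ltr0n//.
  by rewrite ler_wpM2l// ler_nat.
have [Y hY] := hardy_remainder v0 hT yv.
(* [c j] is the sum of [a k * zeta ^+ k] over [k > j], after summation by
   parts: this form converges absolutely. *)
pose c j := Y - \sum_(0 <= r < j) y r - T j / j.+1%:R.
have c2 : sum_bounded (fun j => normc (c j) ^+ 2).
  apply: (sum_bounded_le (v := fun j => 2 * normc (Y - \sum_(0 <= r < j) y r) ^+ 2 +
    2 * normc (- (T j / j.+1%:R)) ^+ 2)).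
    by move=> j; exact: sqr_normcD_le.
  apply: sum_boundedD; apply: sum_boundedZ => //.
  apply: (sum_bounded_le (v := fun j => if j is k.+1 then v k ^+ 2 else 0)); last first.
    by apply: sum_bounded_cons => // j; exact: sqr_ge0.
  case=> [|k]; first by rewrite /T /weighted_sum big_ord0 mul0r oppr0 normc0 expr0n.
  rewrite normcN normcM normcV normc_nat; apply: lerXn2r; rewrite ?nnegrE//.
    by rewrite divr_ge0// normc_ge0.
  apply: ler_wpM2l; first exact: normc_ge0.
  by rewrite lef_pV2 ?posrE ?ltr0n// ler_nat.
have z0 : zeta != 0.
  by apply/eqP => z0; move: z1; rewrite z0 normc0 => /esym/eqP; rewrite oner_eq0.
have cd j : c j - c j.+1 = a j.+1 * zeta ^+ j.+1.
  have Tr : T j.+1 = T j + j.+1%:R * a j.+1 * zeta ^+ j.+1.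
    by rewrite /T /weighted_sum big_ord_recr.
  have yE : y j = T j.+1 / (j.+1%:R * j.+2%:R) by [].
  rewrite /c big_nat_recr//= yE Tr.
  have := nat0 j; have := nat0 j.+1; rewrite -[j.+2%:R]natr1.
  move: (\sum_(0 <= r < j) _) (T j) (j.+1%:R : R[i]) (zeta ^+ j.+1) => A B n w h1 h2.
  by field; rewrite h1 h2.
exists (fun j => c j / zeta ^+ j.+1).
  case: c2 => M hM; exists M => N; rewrite (le_trans _ (hM N))// ler_sum// => j _.
  by rewrite normcM normcV normcX z1 expr1n invr1 mulr1.
move=> j; apply: (mulIf (expf_neq0 j.+1 z0)); rewrite -cd [zeta ^+ j.+2]exprS.
have := expf_neq0 j.+1 z0; move: (zeta ^+ j.+1) => w w0.
by field; rewrite z0 w0.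
Qed.

Lemma one_point_representation (zeta : R[i]) f a : normc zeta = 1 ->
  taylor_on_disk f a ->
  sum_bounded (fun r => (normc (weighted_sum zeta a r.+1) / r.+1%:R) ^+ 2) ->
  exists alpha g, H2 g /\ forall z, disk z -> f z = alpha + (z - zeta) * g z.
Proof.
move=> z1 fa hT; have [g hg ag] := one_point_coefs z1 hT.
have [G hG] := disk_summable_taylor (H2_seq_disk_summable hg).
(* The coefficient of degree 0 forces [alpha]: [a 0 = alpha - zeta * g 0]. *)
exists (a 0%N + zeta * g 0%N), G; split; first by apply/H2P; exists g.
move=> z dz.
have := taylor_sub (taylor_cons (a 0%N + zeta * g 0%N) hG) (taylor_scale zeta hG).
have -> : (fun j => seq_cons (a 0%N + zeta * g 0%N) g j - zeta * g j) = a.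
  by apply/funext => -[|j]; rewrite /seq_cons/= ?addrK// ag.
by move=> /(_ z dz) h; rewrite (cvgc_unique (fa z dz) h); ring.
Qed.
End one_point.

(** * The weighted Dirichlet integral *)

Section derivative.
Variable R : realType.
Implicit Types (f : R[i] -> R[i]) (a : nat -> R[i]).

(** The quotient [(1 - t^j) / (1 - t)] is a sum of [j] powers of [t], each at least [t^j]. *)
Lemma mulr_nat_exp_le (t : R) j : 0 <= t -> t < 1 -> j%:R * t ^+ j <= (1 - t)^-1.
Proof.
move=> t0 t1; rewrite -[leRHS]mul1r ler_pdivlMr ?subr_gt0//.
suff : j%:R * t ^+ j * (1 - t) <= 1 - t ^+ j.
  by move=> h; apply: le_trans h _; rewrite gerBl exprn_ge0.
elim: j => [|j IH]; first by rewrite expr0 mul0r mul0r subrr.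
have tj : t ^+ j.+1 <= 1 by rewrite exprn_ile1// ltW.
rewrite exprS in tj *; rewrite -natr1.
have h1 := ler_wpM2l t0 IH.
have h2 : 0 <= (1 - t) * (1 - t * t ^+ j) by rewrite mulr_ge0// subr_ge0// ltW.
lra.
Qed.

Lemma disk_summable_mulr_nat a : disk_summable a ->
  disk_summable (fun j => j%:R * a j).
Proof.
move=> /disk_summableP ba; apply/disk_summableP => r r0 r1.
have [q [q0 q1 rq]] : exists q, [/\ 0 < q, q < 1 & r < q].
  by exists ((r + 1) / 2); split; lra.
have [M M0 hM] := ba q (ltW q0) q1.
have t1 : r / q < 1 by rewrite ltr_pdivrMr// mul1r.
have t0 : 0 <= r / q by rewrite divr_ge0// ltW.
exists (M * (1 - r / q)^-1) => [|j].
  by rewrite mulr_ge0// invr_ge0 subr_ge0 ltW.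
have -> : normc (j%:R * a j) * r ^+ j = (normc (a j) * q ^+ j) * (j%:R * (r / q) ^+ j).
  rewrite normcM normc_nat expr_div_n; have := expf_neq0 j (lt0r_neq0 q0).
  by move: (q ^+ j) => w w0; field.
apply: ler_pM; rewrite ?mulr_ge0 ?normc_ge0 ?exprn_ge0 ?(ltW q0)//.
exact: mulr_nat_exp_le.
Qed.

Definition deriv_seq a : nat -> R[i] := fun j => j.+1%:R * a j.+1.

Lemma disk_summable_deriv a : disk_summable a -> disk_summable (deriv_seq a).
Proof.
move=> /disk_summable_mulr_nat sa r r0 r1.
(* The shift of index below costs a division by [r]. *)
have [->|rN0] := eqVneq r 0.
  exists (normc (deriv_seq a 0%N)) => -[|N]; first by rewrite big_geq// normc_ge0.
  rewrite big_nat_recl// expr0 mulr1 big1 ?addr0// => j _.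
  by rewrite expr0n mulr0.
have rp : 0 < r by rewrite lt_neqAle eq_sym rN0.
have hs := sum_bounded_shift 1 (fun j => mulr_ge0 (normc_ge0 _) (exprn_ge0 j r0)) (sa
  r r0 r1).
apply: sum_bounded_le (sum_boundedZ (ltW (_ : 0 < r^-1)) hs); last by rewrite invr_gt0.
move=> j; rewrite addn1 /deriv_seq exprS le_eqVlt; apply/orP; left; apply/eqP.
by move: (normc _) (r ^+ j) => u w; field.
Qed.

Lemma normc_expB_le (z w : R[i]) (r : R) j : 0 <= r -> normc z <= r -> normc w <= r ->
  normc (w ^+ j - z ^+ j) * r <= normc (w - z) * (j%:R * r ^+ j).
Proof.
move=> r0 zr wr; rewrite subrXX normcM -mulrA; apply: ler_wpM2l; first exact: normc_ge0.
apply: (@le_trans _ _ ((\sum_(i < j) r ^+ j.-1) * r)).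
  apply: ler_wpM2r => //; apply: le_trans (normc_sum _ _ _) _; apply: ler_sum => i _.
  rewrite normcM !normcX (_ : r ^+ j.-1 = r ^+ (j.-1 - i) * r ^+ i); last first.
    by rewrite -exprD subnK// -ltnS (ltn_predK (ltn_ord i)).
  by apply: ler_pM; rewrite ?exprn_ge0 ?normc_ge0//; apply: lerXn2r; rewrite ?nnegrE
    ?normc_ge0.
rewrite sumr_const card_ord -[_ *+ j]mulr_natl -mulrA.
by case: j => [|j]; rewrite ?mul0r// /= -exprSr.
Qed.

(** The factor [w - z] comes out twice, from [w^(j+1) - z^(j+1)] and then from each
    [w^(j-i) - z^(j-i)]. The natural bound [(j + 1)^2 r^(j-1)] is written with [r^-2] in front, so
    that summation over [j] meets the series of [j^2 |a j| r^j]. *)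
Lemma normc_diffquot_le (z w : R[i]) (r : R) j : 0 < r -> normc z <= r -> normc w <= r ->
  normc (w ^+ j.+1 - z ^+ j.+1 - (w - z) * (j.+1%:R * z ^+ j)) <=
  normc (w - z) ^+ 2 * (r ^- 2 * (j.+1%:R * (j.+1%:R * r ^+ j.+1))).
Proof.
move=> r0 zr wr.
have -> : w ^+ j.+1 - z ^+ j.+1 - (w - z) * (j.+1%:R * z ^+ j) =
  (w - z) * \sum_(i < j.+1) (w ^+ (j - i) - z ^+ (j - i)) * z ^+ i.
  rewrite subrXX -mulrBr; congr (_ * _).
  have -> : j.+1%:R * z ^+ j = \sum_(i < j.+1) z ^+ (j - i) * z ^+ i.
    transitivity (\sum_(i < j.+1) z ^+ j).
      by rewrite sumr_const card_ord mulr_natl.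
    by apply: eq_bigr => i _; rewrite -exprD subnK// -ltnS.
  by rewrite -sumrB; apply: eq_bigr => i _; rewrite mulrBl.
rewrite normcM expr2 -mulrA; apply: ler_wpM2l; first exact: normc_ge0.
apply: le_trans (normc_sum _ _ _) _.
have B (i : 'I_j.+1) : normc ((w ^+ (j - i) - z ^+ (j - i)) * z ^+ i) <=
    normc (w - z) * (r^-1 * (j.+1%:R * r ^+ j)).
  rewrite normcM normcX.
  have h := normc_expB_le (j - i) (ltW r0) zr wr.
  have zi : normc z ^+ i <= r ^+ i.
    by apply: lerXn2r; rewrite ?nnegrE ?normc_ge0// ltW.
  apply: (@le_trans _ _ (normc (w - z) * ((j - i)%:R * r ^+ (j - i)) * r^-1 * r ^+ i)).
    apply: ler_pM; rewrite ?normc_ge0 ?exprn_ge0 ?normc_ge0//.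
    by rewrite ler_pdivlMr.
  have -> : r ^+ j = r ^+ (j - i) * r ^+ i by rewrite -exprD subnK// -ltnS.
  have ij : (j - i)%:R <= j.+1%:R :> R by rewrite ler_nat; lia.
  have d0 := normc_ge0 (w - z).
  have w0 : 0 <= normc (w - z) * r^-1 * (r ^+ (j - i) * r ^+ i).
    by rewrite !mulr_ge0// ?invr_ge0 ?exprn_ge0// ltW.
  move: (r ^+ (j - i)) (r ^+ i) w0 => x y w0.
  rewrite -subr_ge0 (_ : _ - _ = (j.+1%:R - (j - i)%:R) * (normc (w - z) / r * (x *
    y))); last by ring.
  by rewrite mulr_ge0// subr_ge0.
apply: (@le_trans _ _ (\sum_(i < j.+1) normc (w - z) * (r^-1 * (j.+1%:R * r ^+ j)))).
  by apply: ler_sum => i _; exact: B.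
rewrite sumr_const card_ord -[leLHS]mulr_natl [r ^+ j.+1]exprS le_eqVlt; apply/orP;
  left; apply/eqP.
by move: (r ^+ j) => x; field; rewrite lt0r_neq0.
Qed.

Lemma taylor_diffquot f D a (z : R[i]) : taylor_on_disk f a ->
  taylor_on_disk D (deriv_seq a) -> disk z ->
  exists C r : R, [/\ 0 < r, 0 <= C & forall h : R[i], normc h < r ->
    normc (f (h + z) - f z - h * D z) <= normc h ^+ 2 * C].
Proof.
move=> fa Dd dz.
pose r := (normc z + 1) / 2; have z0 := normc_ge0 z.
have z1 : normc z < 1 by [].
have r0 : 0 < r by rewrite /r; lra.
have r1 : r < 1 by rewrite /r; lra.
(* [C] bounds the series of [j^2 |a j| r^j] at a radius midway between [|z|] and 1. *)
have [C hC] := disk_summable_mulr_nat (disk_summable_mulr_nat (taylor_disk_summable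
  fa)) (ltW r0) r1.
have C0 : 0 <= C by have := hC 0%N; rewrite big_geq.
exists (r ^- 2 * C), (r - normc z); split; first by rewrite /r; lra.
  by rewrite mulr_ge0// invr_ge0 exprn_ge0// ltW.
move=> h hr; have wr : normc (h + z) <= r by have := le_normcD h z; lra.
have zr : normc z <= r by rewrite /r; lra.
have dw : disk (h + z) by rewrite /disk/=; exact: le_lt_trans wr r1.
have hw : (fun n => series (fun j => a j * (h + z) ^+ j) n.+1) @ \oo --> f (h + z).
  by have := fa _ dw; rewrite -cvg_shiftS.
have hz : (fun n => series (fun j => a j * z ^+ j) n.+1) @ \oo --> f z.
  by have := fa _ dz; rewrite -cvg_shiftS.
have lim : (fun n => series (fun j => a j * (h + z) ^+ j) n.+1 -
    series (fun j => a j * z ^+ j) n.+1 - h * series (fun j => deriv_seq a j * z ^+ j) n)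
    @ \oo --> f (h + z) - f z - h * D z.
  exact: (cvgc_sub (cvgc_sub hw hz) (cvgc_scale h (Dd _ dz))).
rewrite -[X in normc X]subr0.
apply: (cvgc_normc_le 0%N lim) => n _; rewrite subr0 /series/=.
rewrite !big_nat_recl//= !expr0 opprD addrACA subrr add0r -sumrB mulr_sumr -sumrB.
apply: le_trans (normc_sum _ _ _) _.
apply: (@le_trans _ _ (\sum_(0 <= i < n) normc h ^+ 2 * (r ^- 2 *
    (normc (i.+1%:R * (i.+1%:R * a i.+1)) * r ^+ i.+1)))).
  apply: ler_sum => i _.
  have -> : a i.+1 * (h + z) ^+ i.+1 - a i.+1 * z ^+ i.+1 - h * (deriv_seq a i * z ^+ i) =
    a i.+1 * ((h + z) ^+ i.+1 - z ^+ i.+1 - (h + z - z) * (i.+1%:R * z ^+ i)).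
    by rewrite /deriv_seq addrK; ring.
  rewrite normcM !(normcM i.+1%:R) normc_nat.
  have := normc_diffquot_le i r0 zr wr; rewrite addrK => hd.
  apply: le_trans (ler_wpM2l (normc_ge0 _) hd) _.
  by rewrite le_eqVlt; apply/orP; left; apply/eqP; ring.
rewrite -!mulr_sumr; apply: ler_wpM2l; first exact: sqr_ge0.
apply: ler_wpM2l; first by rewrite invr_ge0 exprn_ge0// ltW.
apply: le_trans (hC n.+1); rewrite big_nat_recl//= lerDr.
by rewrite mulr_ge0 ?normc_ge0.
Qed.

Lemma cvg_diffquot_numField (K : numFieldType) (f : K -> K) (z l : K) :
  (h^-1 *: (f (h + z) - f z) : K^o) @[h --> (0 : K)^'] --> l ->
  derive1 (f : K -> K^o) z = l.
Proof. by move=> /cvg_lim; apply. Qed.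

Lemma near_dnbhs_numField (K : numFieldType) (P : K -> Prop) (r : K) : 0 < r ->
  (forall h, h != 0 -> `|h| < r -> P h) -> \forall h \near (0 : K)^', P h.
Proof.
move=> r0 hP; near=> h; apply: hP; first by near: h; exact: nbhs_dnbhs_neq.
near: h; apply: dnbhs0_lt; exact: r0.
Unshelve. all: by end_near. Qed.
End derivative.

Section dirichlet_space.
Variable R : realType.
Local Notation mu := (@lebesgue_measure R).
Local Notation mu2 := (@lebesgue_measure R \x @lebesgue_measure R)%E.
Local Notation plane := (measurableTypeR R * measurableTypeR R)%type.
Implicit Types (f : R[i] -> R[i]) (a : nat -> R[i]).

Lemma taylor_derive1 f D a (z : R[i]) : taylor_on_disk f a ->
  taylor_on_disk D (deriv_seq a) -> disk z -> derive1 f z = D z.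
Proof.
move=> fa Dd dz; apply: (@cvg_diffquot_numField R[i] f z (D z)).
have [C [r [r0 C0 hC]]] := taylor_diffquot fa Dd dz.
apply: (@cvg_numFieldP R[i] _ _ _ _ _).2 => -[e e'].
rewrite ltcE /= => /andP[/eqP ee e0].
(* The quotient differs from [D z] by at most [|h| C], which is below [e] once
   [|h| < e / (C + 1)]. *)
pose q := Num.min r (e / (C + 1)).
have q0 : 0 < q by rewrite lt_min r0 divr_gt0//; lra.
have q0C : 0 < (q%:C : R[i]) by rewrite ltcR.
apply: (@near_dnbhs_numField R[i] _ _ q0C) => h hN0.
rewrite (_ : `|h| = (normc h)%:C)// ltcR => hq.
rewrite ee (_ : `|_| = (normc (D z - h^-1 * (f (h + z) - f z)))%:C)// ltcR.
have hn0 : 0 < normc h.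
  rewrite lt_neqAle normc_ge0 andbT eq_sym; apply: contra hN0 => /eqP/normc_eq0 ->.
  by [].
have -> : D z - h^-1 * (f (h + z) - f z) = - (h^-1 * (f (h + z) - f z - h * D z)).
  by field.
rewrite normcN normcM normcV ltr_pdivrMl//.
have hr : normc h < r by apply: lt_le_trans hq _; rewrite ge_min lexx.
apply: le_lt_trans (hC h hr) _; rewrite expr2 -mulrA ltr_pM2l//.
have he : normc h < e / (C + 1) by apply: lt_le_trans hq _; rewrite ge_min lexx orbT.
move: he; rewrite ltr_pdivlMr; last by lra.
nra.
Qed.

(* No measurability is needed: the integral of a nonnegative function is a
   supremum over simple functions. *)
Lemma ge0_le_integral_nonmeasurable d (T : measurableType d)
    (m : {measure set T -> \bar R}) (D : set T) (g h : T -> \bar R) :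
  (forall x, D x -> 0 <= g x)%E -> (forall x, D x -> g x <= h x)%E ->
  (\int[m]_(x in D) g x <= \int[m]_(x in D) h x)%E.
Proof.
move=> g0 gh; rewrite [leLHS]integral_mkcond [leRHS]integral_mkcond.
have h1 x : (0 <= (g \_ D) x)%E by apply: erestrict_ge0.
have h2 x : ((g \_ D) x <= (h \_ D) x)%E by exact: lee_restrict.
rewrite !ge0_integralTE//; last by move=> x; exact: le_trans (h1 x) (h2 x).
apply: ub_ereal_sup => _ [k kg <-]; apply: ereal_sup_ubound; exists k => //.
by move=> x; exact: le_trans (kg x) (h2 x).
Qed.

Lemma open_setC1_numField (K : numFieldType) (x : K) : open (~` [set x]).
Proof.
apply: closed_openC; apply: (@accessible_closed_set1 K^o).
exact/hausdorff_accessible/(@norm_hausdorff K K^o).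
Qed.

Lemma measurable_borelC_set1 (zeta : R[i]) : measurable ([set zeta] : set (borelC R)).
Proof.
rewrite -[X in measurable X]setCK; apply: measurableC.
by apply: sub_sigma_algebra; exact: (@open_setC1_numField R[i] zeta).
Qed.

(** The kernel dominates its value at [zeta k] times the indicator of that point, whose mass is at
    least [c k]. *)
Lemma poisson_atomic_ge (s : nat) (zeta : 'I_s -> R[i]) (c : 'I_s -> {posnum R})
    (k : 'I_s) (z : R[i]) : normc (zeta k) = 1 -> normc z < 1 ->
  (((c k)%:num * ((1 - normc z ^+ 2) / normc (z - zeta k) ^+ 2))%:E <=
   poisson (atomic_measure zeta c) z)%E.
Proof.
move=> zk z1; rewrite /poisson.
have z2 : 0 <= 1 - normc z ^+ 2 by rewrite subr_ge0 exprn_ile1 ?normc_ge0// ltW.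
pose g (w : borelC R) := ((1 - normc z ^+ 2) / normc (z - w) ^+ 2)%:E.
have g0 w : (0 <= g w)%E by rewrite lee_fin divr_ge0// sqr_ge0.
rewrite integral_mkcond.
pose v := (1 - normc z ^+ 2) / normc (z - zeta k) ^+ 2.
have v0 : 0 <= v by rewrite divr_ge0// sqr_ge0.
apply: (@le_trans _ _ (\int[atomic_measure zeta c]_w
    (v%:E * (\1_([set zeta k] : set (borelC R)) w)%:E))%E); last first.
  apply: ge0_le_integral_nonmeasurable => w _; first by rewrite mule_ge0// lee_fin.
  rewrite indicE patchE; have [->|wz] := eqVneq w (zeta k).
    by rewrite !mem_set//= mule1.
  rewrite memNset/=; last by move=> /eqP; rewrite (negbTE wz).
  by rewrite mule0; case: ifP => // _; exact: g0.
have m1 := measurable_borelC_set1 (zeta k).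
rewrite ge0_integralZl_EFin//; last exact/measurable_EFinP/measurable_indic.
rewrite integral_indic// setIT -/v mulrC EFinM.
apply: lee_wpmul2l; first by rewrite lee_fin.
rewrite /= /atomic_measure (bigD1 k)//= diracE mem_set// mule1 leeDl//.
by apply: sume_ge0 => j _; rewrite mule_ge0// ?lee_fin// diracE.
Qed.

(** Dividing a series by [1 - zeta^-1 z] replaces its coefficients by the partial sums twisted by
    powers of [zeta]. They stay bounded at radius [r < 1] because [r^j <= r^k] for [k <= j]. *)
Lemma weighted_sum_quotient (zeta : R[i]) D a : normc zeta = 1 ->
  taylor_on_disk D (deriv_seq a) ->
  exists F b, [/\ taylor_on_disk F b,
    forall j, normc (b j) = normc (weighted_sum zeta a j.+1) &
    forall z, disk z -> D z = (1 - zeta^-1 * z) * F z].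
Proof.
move=> z1 Dd.
have z0 : zeta != 0.
  by apply/eqP => z0; move: z1; rewrite z0 normc0 => /esym/eqP; rewrite oner_eq0.
pose b j := weighted_sum zeta a j.+1 / zeta ^+ j.+1.
have bn j : normc (b j) = normc (weighted_sum zeta a j.+1).
  by rewrite normcM normcV normcX z1 expr1n invr1 mulr1.
have sb : disk_summable b.
  apply/disk_summableP => r r0 r1; have [M hM] := taylor_disk_summable Dd r0 r1.
  exists M => [|j]; first by have := hM 0%N; rewrite big_geq.
  apply: le_trans (hM j.+1); rewrite bn big_mkord.
  apply: (@le_trans _ _ ((\sum_(k < j.+1) normc (deriv_seq a k)) * r ^+ j)).
    apply: ler_wpM2r; first exact: exprn_ge0.
    apply: le_trans (normc_sum _ _ _) _; apply: ler_sum => k _.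
    by rewrite normcM normcX z1 expr1n mulr1.
  rewrite mulr_suml; apply: ler_sum => k _; apply: ler_wpM2l; first exact: normc_ge0.
  by apply: ler_wiXn2l => //; [exact: ltW|rewrite -ltnS].
have [F Fb] := disk_summable_taylor sb.
exists F, b; split=> // z dz.
have := taylor_sub Fb (taylor_scale zeta^-1 (taylor_cons 0 Fb)).
have -> : (fun j => b j - zeta^-1 * seq_cons 0 b j) = deriv_seq a.
  apply/funext => -[|j]; rewrite /seq_cons /b /weighted_sum /deriv_seq.
    by rewrite big_ord_recr/= big_ord0 add0r mulr0 subr0 expr1; field.
  rewrite [\sum_(k < j.+2) _]big_ord_recr/= [zeta ^+ j.+2]exprS.
  have := expf_neq0 j.+1 z0; move: (zeta ^+ j.+1) (\sum_(k < j.+1) _) => w B w0.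
  by field; rewrite z0 w0.
by move=> /(_ z dz) h; rewrite (cvgc_unique (Dd z dz) h); ring.
Qed.

Lemma Dspace_weighted_sum (s : nat) (zeta : 'I_s -> R[i]) (c : 'I_s -> {posnum R})
    f a (k : 'I_s) : normc (zeta k) = 1 -> taylor_on_disk f a ->
  Dspace (atomic_measure zeta c) f ->
  sum_bounded (fun r => (normc (weighted_sum (zeta k) a r.+1) / r.+1%:R) ^+ 2).
Proof.
move=> z1 fa [_ fD].
have [D Dd] := disk_summable_taylor (disk_summable_deriv (taylor_disk_summable fa)).
have [F [b [Fb bn DF]]] := weighted_sum_quotient z1 Dd.
suff : sum_bounded (fun r => (normc (b r) / r.+1%:R) ^+ 2).
  by apply: sum_bounded_le => r; rewrite bn.
apply: (bergman_coef Fb).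
have z0 : zeta k != 0.
  by apply/eqP => z0; move: z1; rewrite z0 normc0 => /esym/eqP; rewrite oner_eq0.
have ck : 0 < (c k)%:num by [].
set J := (integral _ _ _) in fD.
have Joo : (J < +oo)%E.
  move: fD; rewrite ltey => JN; rewrite ltey; apply: contra JN => /eqP ->.
  by rewrite gt0_muley// lte_fin invr_gt0 pi_gt0.
(* The factor [|z - zeta k|^-2] of the Poisson kernel cancels [|1 - z / zeta k|^2] in [|f'|^2],
   leaving the density of [F]. *)
have : ((c k)%:num%:E * \int[mu2]_(p in @pdisk R) (bergman_density F p)%:E <= J)%E.
  rewrite -ge0_integralZl_EFin//; last 3 first.
  - exact: measurable_pdisk.
  - by move=> p dp; rewrite lee_fin bergman_density_ge0.
  - exact: measurable_bergman_density Fb.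
  apply: ge0_le_integral_nonmeasurable => p dp.
    by rewrite mule_ge0// lee_fin ?(ltW ck)// bergman_density_ge0.
  rewrite -[(p.1 +i* p.2)%C]/(cplane p) (taylor_derive1 fa Dd)//.
  have := poisson_atomic_ge c z1 dp => /(lee_wpmul2l (_ : (0 <= (normc (D (cplane p))
    ^+ 2)%:E)%E)).
  rewrite lee_fin sqr_ge0 => /(_ isT); apply: le_trans.
  rewrite -!EFinM lee_fin /bergman_density DF//.
  have -> : 1 - (zeta k)^-1 * cplane p = - (zeta k)^-1 * (cplane p - zeta k) by field.
  rewrite !normcM normcN normcV z1 invr1 mul1r /sqmod.
  have nz : normc (cplane p - zeta k) != 0.
    apply/eqP => /normc_eq0/eqP; rewrite subr_eq0 => /eqP pz.
    by have : normc (cplane p) < 1 by []; rewrite pz z1 ltxx.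
  by rewrite le_eqVlt; apply/orP; left; apply/eqP; field.
move=> h; have := le_lt_trans h Joo.
apply: contraTT; rewrite -!leNgt !leye_eq => /eqP ->.
by rewrite gt0_muley// lte_fin.
Qed.
End dirichlet_space.

(** * Interpolation at several points and boundary values *)

Section interpolation.
Variable R : realType.
Implicit Types (f g G : R[i] -> R[i]) (a : nat -> R[i]) (p q t : {poly R[i]}).

Lemma H2_add g G : H2 g -> H2 G -> H2 (fun z => g z + G z).
Proof.
move=> /H2P[a ga ha] /H2P[b gb hb]; apply/H2P.
exists (fun j => a j + b j); first exact: taylor_add.
apply: (sum_bounded_le _ (sum_boundedD (sum_boundedZ (_ : 0 <= 2) ha) (sum_boundedZ
  (_ : 0 <= 2) hb))) => // j.
exact: sqr_normcD_le.
Qed.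

Lemma H2_scale c g : H2 g -> H2 (fun z => c * g z).
Proof.
move=> /H2P[a ga ha]; apply/H2P; exists (fun j => c * a j); first exact: taylor_scale.
apply: (sum_bounded_le _ (sum_boundedZ (sqr_ge0 (normc c)) ha)) => j.
by rewrite normcM exprMn.
Qed.

Lemma H2_mulX g : H2 g -> H2 (fun z => z * g z).
Proof.
move=> /H2P[a ga ha]; apply/H2P; exists (seq_cons 0 a).
  by have := taylor_cons 0 ga; under eq_fun do rewrite add0r.
apply: (sum_bounded_le _ (sum_bounded_cons 0 (fun j => sqr_ge0 (normc (a j))) ha)) =>
  -[|j]; last exact: lexx.
by rewrite /seq_cons normc0 expr0n.
Qed.

Lemma H2_mul_poly p g : H2 g -> H2 (fun z => p.[z] * g z).
Proof.
move=> hg; elim/poly_ind: p => [|p c IH].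
  by have := H2_scale 0 hg; congr H2; apply/funext => z; rewrite horner0.
have := H2_add (H2_mulX IH) (H2_scale c hg).
by congr H2; apply/funext => z; rewrite hornerMXaddC; ring.
Qed.

Lemma H2_poly p : H2 (horner p).
Proof.
apply/H2P; exists (fun j => p`_j); first exact: taylor_poly.
exists (\sum_(0 <= j < size p) normc p`_j ^+ 2) => N.
have p0 j : 0 <= normc p`_j ^+ 2 by exact: sqr_ge0.
have [Ns|sN] := leqP N (size p).
  by rewrite [leRHS](big_cat_nat (n := N))//= lerDl sumr_ge0.
rewrite [leLHS](big_cat_nat (n := size p))//= ?(ltnW sN)//.
rewrite [X in _ + X <= _]big_nat [X in _ + X <= _]big1 ?addr0// => j /andP[sj _].
by rewrite nth_default// normc0 expr0n.
Qed.

Lemma H2_sub g G : H2 g -> H2 G -> H2 (fun z => g z - G z).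
Proof.
move=> hg hG; have := H2_add hg (H2_scale (-1) hG).
by congr H2; apply/funext => z; rewrite mulN1r.
Qed.

Lemma poly_sub_horner p (x : R[i]) : exists t, p = p.[x]%:P + ('X - x%:P) * t.
Proof.
have : root (p - p.[x]%:P) x by rewrite rootE hornerD hornerN hornerC subrr.
move=> /factor_theorem[t pt]; exists t.
by rewrite mulrC -pt addrC subrK.
Qed.

Definition nodal (zs : seq R[i]) : {poly R[i]} := \prod_(x <- zs) ('X - x%:P).

Lemma size_nodal zs : size (nodal zs) = (size zs).+1.
Proof. by rewrite /nodal size_prod_XsubC. Qed.

Lemma nodal_neq0 zs (z : R[i]) : z \notin zs -> (nodal zs).[z] != 0.
Proof. by rewrite -root_prod_XsubC. Qed.

(** One node [x] is added at a time. With [p = p(x) + (z - x) t] and [q = q(x) + (z - x) r],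
    equating the two expressions of [f] gives [q(x) g = (alpha - p(x)) + (z - x) (G - r g - t)]. As
    [q(x)] is nonzero, [g] is thus [beta + (z - x) g'] with [g'] in H^2. The induction starts at a
    single node, since an empty list carries no information on [f]. *)
Lemma interpolation_representation f (zs : seq R[i]) : uniq zs ->
  (forall x, x \in zs -> exists alpha g, H2 g /\
    forall z, disk z -> f z = alpha + (z - x) * g z) ->
  zs != [::] ->
  exists p g, [/\ (size p <= size zs)%N, H2 g &
    forall z, disk z -> f z = p.[z] + (nodal zs).[z] * g z].
Proof.
elim: zs => [//|x zs IH] /=/andP[xzs uzs] hx _.
have [alpha [G [hG fG]]] := hx x (mem_head _ _).
have [->|zs0] := eqVneq zs [::].
  exists alpha%:P, G; split=> //; first by rewrite size_polyC; case: (_ != _).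
  by move=> z dz; rewrite /nodal big_seq1 !hornerE fG.
have [y yzs|p [g [sp hg fp]]] := IH uzs _ zs0.
  by apply: hx; rewrite inE yzs orbT.
have qx := nodal_neq0 xzs; set q := nodal zs in qx fp *.
have [r qr] := poly_sub_horner q x.
have [t pt] := poly_sub_horner p x.
pose beta := (alpha - p.[x]) / q.[x].
pose g' z := q.[x]^-1 * (G z - r.[z] * g z - t.[z]).
have gE z : disk z -> g z = beta + (z - x) * g' z.
  move=> dz; have E := fp z dz; rewrite (fG z dz) {1}qr {1}pt !hornerE in E.
  rewrite /beta /g'; move: qx E.
  move: (G z) (p.[x]) (t.[z]) (q.[x]) (r.[z]) (g z) => u P v Q w y Q0 E.
  have E2 : Q * y = (P + (z - x) * v + (Q + (z - x) * w) * y) -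
    (P + (z - x) * v + (z - x) * w * y) by ring.
  by rewrite -E in E2; apply: (mulfI Q0); rewrite E2; field.
exists (p + beta%:P * q), g'; split.
- apply: leq_trans (size_polyD _ _) _; rewrite geq_max (leq_trans sp)//=.
  apply: leq_trans (size_polyMleq _ _) _; rewrite size_nodal size_polyC.
  by case: (beta != 0) => /=; lia.
- by apply: H2_scale; apply: H2_sub (H2_poly t); apply: H2_sub hG (H2_mul_poly r hg).
move=> z dz; rewrite fp// gE// (_ : nodal (x :: zs) = ('X - x%:P) * q); last first.
  by rewrite /nodal big_cons.
rewrite hornerD !hornerM hornerC hornerXsubC.
by move: (g' z) => w; ring.
Qed.

(** Termwise [|a j| r^j <= |a j|^2 / l + l r^j], by the arithmetic-geometric inequality and
    [r^(2j) <= r^j]. The free parameter [l] plays the role of Cauchy-Schwarz. *)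
Lemma H2_radial_bound g a (A l r : R) (zeta : R[i]) : taylor_on_disk g a ->
  (forall N, \sum_(0 <= j < N) normc (a j) ^+ 2 <= A) -> normc zeta = 1 ->
  0 <= r -> r < 1 -> 0 < l ->
  (1 - r) * normc (g (r%:C * zeta)) <= (1 - r) * A / l + l.
Proof.
move=> ga hA z1 r0 r1 l0.
have nz : normc (r%:C * zeta) = r by rewrite normcM normc_real ger0_norm// z1 mulr1.
have dz : disk (r%:C * zeta) by rewrite /disk/= -/(normc _) nz.
have r1' : 0 < 1 - r by rewrite subr_gt0.
suff : normc (g (r%:C * zeta) - 0) <= A / l + l * (1 - r)^-1.
  rewrite subr0 => h; have := ler_wpM2l (ltW r1') h.
  rewrite mulrDr [(1 - r) * (l * _)]mulrCA divff ?gt_eqF// mulr1.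
  by rewrite mulrA.
apply: (cvgc_normc_le 0%N (ga _ dz)) => n _; rewrite subr0 /series/=.
apply: le_trans (normc_sum _ _ _) _.
apply: (@le_trans _ _ (\sum_(0 <= j < n) (l^-1 * normc (a j) ^+ 2 + l * r ^+ j))).
  apply: ler_sum => j _; rewrite normcM normcX nz.
  have rj0 : 0 <= r ^+ j by exact: exprn_ge0.
  have rj1 : r ^+ j <= 1 by rewrite exprn_ile1// ltW.
  have u0 := normc_ge0 (a j); set u := normc (a j) in u0 *.
  have : (r ^+ j) ^+ 2 <= r ^+ j by rewrite expr2; nra.
  move: (r ^+ j) rj0 rj1 => w w0 w1 w2.
  have h := sqr_ge0 (u - l * w).
  have h2 : l * (u * w) <= u ^+ 2 + l ^+ 2 * w by nra.
  rewrite -(ler_pM2l l0) (_ : l * (_ + _) = u ^+ 2 + l ^+ 2 * w)//.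
  by field; rewrite gt_eqF.
rewrite big_split/= -!mulr_sumr; apply: lerD.
  by rewrite mulrC; apply: ler_wpM2r => //; rewrite invr_ge0 ltW.
apply: ler_wpM2l; first exact: ltW.
rewrite -[leRHS]mul1r ler_pdivlMr//.
suff -> : (\sum_(0 <= j < n) r ^+ j) * (1 - r) = 1 - r ^+ n by rewrite gerBl exprn_ge0.
elim: n => [|n IH]; first by rewrite big_geq// mul0r expr0 subrr.
by rewrite big_nat_recr//= mulrDl IH exprS; ring.
Qed.

Lemma radial_lim_one_point f G (alpha zeta : R[i]) : normc zeta = 1 -> H2 G ->
  (forall z, disk z -> f z = alpha + (z - zeta) * G z) -> radial_lim f zeta = alpha.
Proof.
move=> z1 /H2P[a Ga [A hA]] fG; apply: cvgc_lim; apply/cvg_normc.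
have A0 : 0 <= A by have := hA 0%N; rewrite big_geq.
apply/cvgrPdist_le => e e0; near=> r.
have r1 : r < 1 by near: r; exact: nbhs_left_lt.
have r0 : 0 <= r by apply: ltW; near: r; exact: nbhs_left_gt.
(* With [l = e / 2] in the radial bound, this makes [(1 - r) * A / l] at most [e / 2] as well. *)
have rA : 1 - (e / 2) ^+ 2 / (A + 1) < r.
  near: r; apply: nbhs_left_gt; rewrite ltrBlDr ltrDl divr_gt0//; last by lra.
  by rewrite exprn_gt0// divr_gt0.
rewrite sub0r normrN ger0_norm ?normc_ge0//.
have dz : disk (r%:C * zeta).
  by rewrite /disk/= -/(normc _) normcM normc_real ger0_norm// z1 mulr1.
rewrite fG// addrAC subrr add0r.
have -> : r%:C * zeta - zeta = - ((1 - r)%:C * zeta) by rewrite rmorphB rmorph1; ring.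
rewrite mulNr normcN !normcM z1 mulr1 normc_real ger0_norm; last by lra.
have e20 : 0 < e / 2 by rewrite divr_gt0.
apply: le_trans (H2_radial_bound Ga hA z1 r0 r1 e20) _.
have h : (1 - r) * (A + 1) <= (e / 2) ^+ 2.
  by rewrite -ler_pdivlMr; lra.
have : (1 - r) * A / (e / 2) <= e / 2.
  by rewrite ler_pdivrMr// -expr2; nra.
lra.
Unshelve. all: by end_near. Qed.
End interpolation.

(** * Norm and distance to polynomials *)

Section distance.
Variables (R : realType) (s : nat) (zeta : 'I_s -> R[i]).
Hypothesis zeta_circle : forall k, circle (zeta k).
Hypothesis zeta_inj : injective zeta.
Implicit Types (f g : R[i] -> R[i]) (a : nat -> R[i]) (p h : {poly R[i]}).

Let nodes : seq R[i] := [seq zeta i | i <- enum 'I_s].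
Let q := \prod_(k < s) ('X - (zeta k)%:P).

Let size_nodes : size nodes = s. Proof. by rewrite size_map size_enum_ord. Qed.

Let uniq_nodes : uniq nodes.
Proof. by rewrite map_inj_uniq// enum_uniq. Qed.

Let qE : q = nodal nodes.
Proof. by rewrite /nodal /nodes big_map /q big_enum. Qed.

Let size_q : size q = s.+1. Proof. by rewrite qE size_nodal size_nodes. Qed.

Let zeta1 k : normc (zeta k) = 1. Proof. exact: zeta_circle. Qed.

Let q_disk z : disk z -> q.[z] != 0.
Proof.
move=> dz; rewrite qE; apply: nodal_neq0; apply/mapP => -[k _ zk].
by move: dz; rewrite /disk/= zk -/(normc _) zeta1 ltxx.
Qed.

Lemma atomic_Dspace_representation (c : 'I_s -> {posnum R}) f a : (0 < s)%N ->
  taylor_on_disk f a -> Dspace (atomic_measure zeta c) f -> exists g, is_Q zeta f g.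
Proof.
move=> s0 fa fD.
have [|||p [g [sp hg fp]]] := @interpolation_representation R f nodes.
- exact: uniq_nodes.
- move=> x /mapP[k _ ->].
  exact: one_point_representation (zeta1 k) fa (Dspace_weighted_sum (zeta1 k) fa fD).
- by rewrite -size_eq0 size_nodes -lt0n.
exists g; split=> //; exists p; first by rewrite -size_nodes.
by move=> z dz; rewrite -/q qE; exact: fp.
Qed.

(** Both [p - p(zeta k)] and [q] are divisible by [z - zeta k], so [f] has a one-point
    representation with constant [p(zeta k)]. *)
Lemma radial_lim_is_Q f g p k : H2 g ->
  (forall z, disk z -> f z = p.[z] + q.[z] * g z) -> radial_lim f (zeta k) = p.[zeta k].
Proof.
move=> hg fp.
have [t pt] := poly_sub_horner p (zeta k).
have [r qr] := poly_sub_horner q (zeta k).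
have qk : q.[zeta k] = 0 by apply/rootP; rewrite qE root_prod_XsubC map_f ?mem_enum.
have hG := H2_add (H2_poly t) (H2_mul_poly r hg).
apply: (radial_lim_one_point (zeta1 k) hG) => z dz.
rewrite fp// {1}pt {1}qr qk.
rewrite !hornerD !hornerM !hornerC hornerXsubC.
by move: (g z) => w; ring.
Qed.

(** The radial limits of [f] at the [s] nodes determine [p], of degree below [s]; then [g] follows,
    since [q] has no zero in the disk. *)
Lemma is_Q_unique f g1 g2 : is_Q zeta f g1 -> is_Q zeta f g2 ->
  {in disk, g1 =1 g2}.
Proof.
move=> [h1 [p1 s1 f1]] [h2 [p2 s2 f2]].
have E : p1 = p2.
  apply/eqP; rewrite -subr_eq0; apply/eqP.
  apply: (@roots_geq_poly_eq0 _ _ nodes) => //; last first.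
    rewrite size_nodes; apply: leq_trans (size_polyD _ _) _.
    by rewrite size_polyN geq_max s1 s2.
  apply/allP => _ /mapP[k _ ->]; rewrite rootE hornerD hornerN.
  by rewrite -(radial_lim_is_Q k h1 f1) -(radial_lim_is_Q k h2 f2) subrr.
move=> z; rewrite inE => dz; have := f1 z dz; rewrite (f2 z dz) E => /addrI.
by move=> /(mulfI (q_disk dz)).
Qed.

Lemma taylor_coefE g a : taylor_on_disk g a -> taylor_coef g = a.
Proof.
move=> ga; rewrite /taylor_coef.
have : [set a | taylor_on_disk g a] (xget (fun=> 0) [set a | taylor_on_disk g a]).
  by apply: xgetPex; exists a.
by move=> /= h; exact: taylor_unique h ga.
Qed.

(** By uniqueness the chosen [Qop] has the Taylor coefficients of [g], so the norm can be read off
    any representation. *)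
Lemma Dnorm_is_Q f g p a : (size p <= s)%N -> taylor_on_disk g a -> H2_seq a ->
  (forall z, disk z -> f z = p.[z] + q.[z] * g z) ->
  Dnorm zeta f = Num.sqrt (\sum_(k < s) normc p.[zeta k] ^+ 2 +
    limn (series (fun j => normc (a j) ^+ 2))).
Proof.
move=> sp ga ha fp; have hg : H2 g by apply/H2P; exists a.
have Qfg : is_Q zeta f g by split=> //; exists p.
have QQ : is_Q zeta f (Qop zeta f).
  have : [set g | is_Q zeta f g] (Qop zeta f) by apply: xgetPex; exists g.
  by [].
have Qa : taylor_on_disk (Qop zeta f) a := taylor_ext (is_Q_unique Qfg QQ) ga.
congr (Num.sqrt (_ + _)).
  by apply: eq_bigr => k _; rewrite (radial_lim_is_Q k hg fp).
rewrite /H2norm (taylor_coefE Qa) sqr_sqrtr//.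
apply: limr_ge; first by apply/sum_boundedP => // j; exact: sqr_ge0.
by apply: nearW => n; rewrite /series/= sumr_ge0// => j _; exact: sqr_ge0.
Qed.

Lemma inf_min (E : set R) x : E x -> lbound E x -> inf E = x.
Proof.
move=> Ex lbx; apply/eqP; rewrite eq_le; apply/andP; split.
  by apply: ge_inf => //; exists x.
by apply: lb_le_inf => //; exists x.
Qed.

Lemma dist_poly_is_Q f g p a n : (s <= n)%N -> (size p <= s)%N ->
  taylor_on_disk g a -> H2_seq a ->
  (forall z, disk z -> f z = p.[z] + q.[z] * g z) ->
  cvgn (fun N => \sum_(n.+1 <= j < N) normc (a (j - s)%N) ^+ 2) /\
  dist_poly zeta f n =
    Num.sqrt (limn (fun N => \sum_(n.+1 <= j < N) normc (a (j - s)%N) ^+ 2)).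
Proof.
move=> sn sp ga ha fp.
(* A polynomial [q t] has degree at most [n] exactly when [t] has degree below [m]: the coefficients
   of [g] from [m] on are out of reach. *)
pose m := (n.+1 - s)%N; have mE : n.+1 = (m + s)%N by rewrite subnK// ltnW.
pose out N := \sum_(n.+1 <= j < N) normc (a (j - s)%N) ^+ 2.
have outE N : out N = \sum_(m <= i < N - s) normc (a i) ^+ 2.
  rewrite /out; have [sN|Ns] := leqP s N.
    rewrite -{1}(subnK sN) mE big_addn addnK.
    by apply: eq_bigr => i _; rewrite addnK.
  rewrite !big_geq//; first by rewrite (eqP (ltnW Ns)).
  by apply: leq_trans (ltnW Ns) _; rewrite mE leq_addl.
have sq0 (u : nat -> R[i]) j : 0 <= normc (u j) ^+ 2 by exact: sqr_ge0.
have out_nd : {homo out : N M / (N <= M)%N >-> N <= M}.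
  move=> N M NM; have [nN|Nn] := leqP n.+1 N.
    by rewrite /out [leRHS](big_cat_nat (n := N))//= lerDl sumr_ge0.
  by rewrite {1}/out big_geq ?(ltnW Nn)// /out sumr_ge0.
(* Serves both for the lower bound and for computing the norm at the minimizer. *)
have lower (u : nat -> R[i]) : H2_seq u -> (forall j, (m <= j)%N -> u j = a j) ->
    forall N, out N <= limn (series (fun j => normc (u j) ^+ 2)).
  move=> hu ua N; have cu := (sum_boundedP (sq0 u)).1 hu.
  apply: le_trans (nondecreasing_cvgn_le _ cu (N - s)%N); last first.
    exact: nondecreasing_series.
  rewrite outE /series/=; have [mN|Nm] := leqP m (N - s)%N.
    rewrite [leRHS](big_cat_nat (n := m))//= -[leLHS]add0r; apply: lerD.
      by rewrite sumr_ge0.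
    by rewrite !big_nat; apply: ler_sum => j /andP[mj _]; rewrite ua.
  by rewrite big_geq ?(ltnW Nm)// sumr_ge0.
have c_out : cvgn out.
  apply: nondecreasing_is_cvgn => //.
  by exists (limn (series (fun j => normc (a j) ^+ 2))) => _ [N _ <-]; exact: lower.
split=> //; apply: inf_min.
  pose t := \poly_(i < m) a i.
  exists (p + q * t).
    apply: leq_trans (size_polyD _ _) _; rewrite geq_max (leq_trans sp) ?(leq_trans
      sn)//=.
    apply: leq_trans (size_polyMleq _ _) _; rewrite size_q addSn/= mE addnC leq_add2r.
    exact: size_poly.
  pose u j := a j - t`_j.
  have uE j : u j = if (j < m)%N then 0 else a j.
    by rewrite /u coef_poly; case: ifP => _; rewrite ?subrr ?subr0.
  have hu : H2_seq u.
    apply: sum_bounded_le ha => j; rewrite uE; case: ifP => // _.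
    by rewrite normc0 expr0n sqr_ge0.
  have tu : taylor_on_disk (fun z => g z - t.[z]) u := taylor_sub ga (taylor_poly t).
  rewrite (@Dnorm_is_Q _ _ 0 _ _ tu hu) ?size_poly0//; last first.
    move=> z dz; rewrite fp// horner0 hornerD hornerM.
    by move: (g z) => w; ring.
  rewrite big1 ?add0r; last by move=> k _; rewrite horner0 normc0 expr0n.
  congr Num.sqrt; apply/eqP; rewrite eq_le; apply/andP; split; last first.
    apply: limr_le => //; apply: nearW => N; apply: lower => // j mj.
    by rewrite uE ltnNge mj.
  apply: limr_le; first exact: (sum_boundedP (sq0 u)).1 hu.
  apply: nearW => N; apply: le_trans (nondecreasing_cvgn_le out_nd c_out (N + s)%N).
  rewrite outE addnK /series/=; have [mN|Nm] := leqP m N.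
    rewrite (big_cat_nat (n := m))//= big_nat big1 ?add0r; last first.
      by move=> j /= jm; rewrite uE jm normc0 expr0n.
    by rewrite !big_nat; apply: ler_sum => j /andP[mj _]; rewrite uE ltnNge mj.
  rewrite big_nat big1 ?sumr_ge0// => j /= jN.
  by rewrite uE (ltn_trans jN Nm) normc0 expr0n.
move=> _ [h sh <-].
have q0 : q != 0 by rewrite -size_poly_eq0 size_q.
(* Subtracting [h] changes [g] by the quotient, only below index [m], and [p] by the remainder,
   whose contribution to the norm is nonnegative. *)
pose u j := a j - (h %/ q)`_j.
have sd : (size (h %/ q)%R <= m)%N.
  by rewrite size_divp// size_q /m leq_sub// (leq_trans sh).
have ua j : (m <= j)%N -> u j = a j.
  by move=> mj; rewrite /u nth_default ?subr0// (leq_trans sd).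
have tu : taylor_on_disk (fun z => g z - (h %/ q).[z]) u := taylor_sub ga (taylor_poly _).
have hu : H2_seq u.
  have /H2P[v tv hv] : H2 (fun z => g z - (h %/ q).[z]).
    by apply: H2_sub; [apply/H2P; exists a|exact: H2_poly].
  by rewrite (taylor_unique tu tv).
rewrite (@Dnorm_is_Q _ _ (p - h %% q) _ _ tu hu); last 2 first.
- apply: leq_trans (size_polyD _ _) _; rewrite size_polyN geq_max sp/=.
  by rewrite -ltnS -size_q ltn_modp.
- move=> z dz; rewrite fp// {1}(divp_eq h q) !hornerD hornerM hornerN.
  by move: (g z) => w; ring.
apply: ler_wsqrtr; apply: (@le_trans _ _ (limn (series (fun j => normc (u j) ^+ 2)))).
  by apply: limr_le => //; apply: nearW => N; exact: lower.
by rewrite lerDr; apply: sumr_ge0 => k _; exact: sqr_ge0.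
Qed.
End distance.

(** * Complete homogeneous symmetric polynomials *)

Section complete_homogeneous.
Variable R : realType.
Implicit Types (x y : R[i]) (l : seq R[i]) (g : nat -> R[i]).

(* The complete homogeneous symmetric polynomial of degree [k] in the entries of
   [l], through [h_k(x, l) = x h_(k-1)(x, l) + h_k(l)]. *)
Fixpoint chom l : nat -> R[i] :=
  if l is x :: l' then
    fix chom_cons k := if k is k'.+1 then x * chom_cons k' + chom l' k else chom l' 0%N
  else fun k => (k == 0%N)%:R.

Lemma chom0 l : chom l 0 = 1.
Proof. by elim: l => [|x l IH] //=; rewrite IH. Qed.

Lemma chomS x l k : chom (x :: l) k.+1 = x * chom (x :: l) k + chom l k.+1.
Proof. by []. Qed.

(** The generating function is the product of the [1 / (1 - x t)], and multiplication by [1 - y t]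
    removes the factor of [y]. For the head of the list this is the defining recursion. *)
Lemma chom_drop_second x y l k :
  chom (x :: y :: l) k.+1 - y * chom (x :: y :: l) k = chom (x :: l) k.+1.
Proof.
elim: k => [|k IH].
  by rewrite !chomS !chom0; ring.
rewrite [chom (x :: l) _]chomS -IH [chom (x :: y :: l) k.+2]chomS.
rewrite [chom (y :: l) k.+2]chomS [chom (x :: y :: l) k.+1]chomS.
by move: (chom (x :: y :: l) k) (chom (y :: l) k.+1) => u v; ring.
Qed.

Lemma chom_divided_difference x y l k :
  (x - y) * chom (x :: y :: l) k = chom (x :: l) k.+1 - chom (y :: l) k.+1.
Proof.
have := chom_drop_second x y l k; rewrite [chom (x :: y :: l) k.+1]chomS => <-.
by ring.
Qed.

(** The divided difference expresses the value on [x :: y :: l] by those on [x :: l] and [y :: l],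
    at the cost of [1 / |x - y|]. For one unimodular entry the values are its powers. The induction
    is on the length because two different shorter lists occur. *)
Lemma chom_bounded l : uniq l -> (forall x, x \in l -> normc x = 1) ->
  exists M, forall k, normc (chom l k) <= M.
Proof.
have [n] := ubnP (size l); elim: n l => // n IH [|x [|y l]] ln.
- by exists 1 => -[|k]; rewrite /chom ?normc1// normc0.
- move=> _ h; exists 1; elim=> [|k IHk]; first by rewrite chom0 normc1.
  by rewrite chomS /= addr0 normcM h ?mem_head// mul1r.
move=> /=/and3P[]; rewrite inE negb_or => /andP[xy xl] yl ul h.
have [|||M1 h1] := IH (x :: l).
- by rewrite -ltnS.
- by rewrite /= xl.
- by move=> z; rewrite inE => /predU1P[->|zl]; apply: h; rewrite !inE ?eqxx// zl !orbT.
have [|||M2 h2] := IH (y :: l).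
- by rewrite -ltnS.
- by rewrite /= yl.
- by move=> z zl; apply: h; rewrite inE zl orbT.
have xy0 : 0 < normc (x - y).
  rewrite lt_neqAle normc_ge0 andbT eq_sym; apply: contra xy => /eqP/normc_eq0/eqP.
  by rewrite subr_eq0.
exists ((M1 + M2) / normc (x - y)) => k; rewrite ler_pdivlMr// mulrC -normcM.
rewrite chom_divided_difference; apply: le_trans (le_normcD _ _) _.
by rewrite normcN; apply: lerD.
Qed.

(* The product of the operators [1 - x E], [x \in l], [E] the forward shift,
   applied to [g]: these are the coefficients of degree [k + size l] of
   [nodal l] times the series of [g]. *)
Fixpoint lag_coefs l g : nat -> R[i] :=
  if l is x :: l' then fun k => lag_coefs l' g k - x * lag_coefs l' g k.+1 else g.

Lemma lag_coefs_shift l g i k : lag_coefs l (fun j => g (j + i)%N) k = lag_coefs l g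
  (k + i)%N.
Proof. by elim: l k => [|x l IH] k //=; rewrite !IH. Qed.

Lemma lag_coefs_cvg0 l g : g @ \oo --> (0 : R[i]) -> lag_coefs l g @ \oo --> (0 : R[i]).
Proof.
move=> g0; elim: l => [|x l IH]; first exact: g0.
have IHS : (fun k => lag_coefs l g k.+1) @ \oo --> (0 : R[i]) by rewrite cvg_shiftS.
have := cvgc_sub IH (cvgc_scale x IHS); rewrite mulr0 subr0; exact.
Qed.

(** Formally the series of [chom l k] times [E^k] inverts the product of the [1 - x E], and it is
    evaluated at index 0. Removing one entry [x] is a summation by parts through [chomS], with the
    single boundary term [w M]: a bounded factor times one tending to 0. *)
Lemma chom_abel_sum l g : uniq l -> (forall x, x \in l -> normc x = 1) ->
  g @ \oo --> (0 : R[i]) ->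
  (fun M => \sum_(0 <= k < M.+1) lag_coefs l g k * chom l k) @ \oo --> g 0%N.
Proof.
move=> + + g0; elim: l => [|x l IH] ul l1.
  have -> : (fun M => \sum_(0 <= k < M.+1) lag_coefs [::] g k * chom [::] k) = (fun=>
    g 0%N).
    apply/funext => M; rewrite big_nat_recl//= mulr1 big1 ?addr0// => k _.
    by rewrite mulr0.
  exact: cvgc_cst.
have /andP[_ ul'] := ul.
have {}IH := IH ul' (fun z zl => l1 z (mem_behead (s := x :: l) zl)).
pose w M := x * lag_coefs l g M.+1 * chom (x :: l) M.
have -> : (fun M => \sum_(0 <= k < M.+1) lag_coefs (x :: l) g k * chom (x :: l) k) =
    (fun M => \sum_(0 <= k < M.+1) lag_coefs l g k * chom l k - w M).
  have cS := chomS x l; have c0 : chom (x :: l) 0 = chom l 0 by [].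
  apply/funext; rewrite /w; move: (chom (x :: l)) cS c0 => c cS c0.
  elim=> [|M IHM]; first by rewrite !big_nat1 c0 /= chom0; ring.
  rewrite big_nat_recr//= IHM [in RHS]big_nat_recr//= cS.
  move: (\sum_(0 <= k < M.+1) _) (c M) (chom l M.+1) => A B C.
  by ring.
have [K hK] := chom_bounded ul l1.
have w0 : w @ \oo --> (0 : R[i]).
  have vS : (fun k => lag_coefs l g k.+1) @ \oo --> (0 : R[i]).
    by rewrite cvg_shiftS; exact: lag_coefs_cvg0.
  apply: (cvgc_dominated (fun M => K * normc (lag_coefs l g M.+1))).
    move=> M; rewrite subr0 /w !normcM (l1 x (mem_head _ _)) mul1r mulrC.
    by apply: ler_wpM2r; [exact: normc_ge0|exact: hK].
  rewrite -(mulr0 K); apply: cvgM; first exact: cvg_cst.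
  by have := cvg_normc_of vS; rewrite normc0; exact.
rewrite -[g 0%N]subr0; exact: (cvgc_sub IH w0).
Qed.

Fixpoint nodal_coefs l g : nat -> R[i] :=
  if l is x :: l' then
    fun j => seq_cons 0 (nodal_coefs l' g) j - x * nodal_coefs l' g j
  else g.

Lemma taylor_nodal l G g : taylor_on_disk G g ->
  taylor_on_disk (fun z => (nodal l).[z] * G z) (nodal_coefs l g).
Proof.
move=> Gg; elim: l => [|x l IH] /=.
  by apply: taylor_ext Gg => z _; rewrite /nodal big_nil hornerC mul1r.
apply: taylor_ext (taylor_sub (taylor_cons 0 IH) (taylor_scale x IH)) => z _.
rewrite /nodal big_cons hornerM hornerXsubC.
by move: (\prod_(y <- l) _).[z] (G z) => u v; ring.
Qed.

(** From degree [size l] on, the zeros inserted by [seq_cons] are no longer seen. *)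
Lemma nodal_coefsE l g k : nodal_coefs l g (k + size l)%N = lag_coefs l g k.
Proof.
elim: l k => [|x l IH] k /=; first by rewrite addn0.
by rewrite addnS /seq_cons IH -addSn IH.
Qed.
End complete_homogeneous.

(** * Symmetric sums over sorted tuples and recovery of the quotient *)

Section hsym_chom.
Variables (R : realType) (s : nat) (zeta : 'I_s -> R[i]).

Let nodes : seq R[i] := [seq zeta i | i <- enum 'I_s].

(** The lower bound [m] on the indices restricts the sum to the variables
    [zeta m, ..., zeta (s - 1)], which permits a recursion on the number of variables. *)
Let adm (m : nat) (t : seq 'I_s) :=
  sorted leq [seq val i | i <- t] && all (leq m) [seq val i | i <- t].

Let tail_sum m k : R[i] := \sum_(t : k.-tuple 'I_s | adm m t) \prod_(i <- t) zeta i.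

Let adm_cons m (i : 'I_s) t : (i = m :> nat) -> adm m (i :: t) = adm m t.
Proof.
move=> im; rewrite /adm /= im leqnn /= path_sortedE; last exact: leq_trans.
by rewrite andbAC andbb andbC.
Qed.

Let adm_consS m (i : 'I_s) t : (i != m :> nat) -> adm m (i :: t) = adm m.+1 (i :: t).
Proof.
move=> im; rewrite /adm /= path_sortedE; last exact: leq_trans.
rewrite leq_eqVlt [m == _]eq_sym (negbTE im) /=.
case: ltnP => mi; last by rewrite !andbF.
case: (boolP (all (leq i) _)) => // /allP h /=; congr (_ && _).
have h1 : all (leq m) [seq val j | j <- t].
  by apply/allP => j /h; apply: leq_trans; exact: ltnW.
have h2 : all (leq m.+1) [seq val j | j <- t].
  by apply/allP => j /h; exact: leq_trans.
by rewrite h1 h2.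
Qed.

(** In a sorted tuple with entries at least [m], either the head is [m] and can be removed, or every
    entry is at least [m + 1]. *)
Let tail_sum_rec m k (ms : (m < s)%N) :
  tail_sum m k.+1 = zeta (Ordinal ms) * tail_sum m k + tail_sum m.+1 k.+1.
Proof.
pose im := Ordinal ms.
have cons_thead (t : k.+1.-tuple 'I_s) : tval t = thead t :: behead t.
  by rewrite {1}(tuple_eta t).
rewrite /tail_sum (bigID (fun t : k.+1.-tuple 'I_s => thead t == im))/=; congr (_ + _).
  rewrite (reindex_onto (fun t => cons_tuple im t) (fun t => behead_tuple t))/=; last
    first.
    by move=> t /andP[_ /eqP tm]; apply/val_inj; rewrite /= [RHS]cons_thead tm.
  rewrite mulr_sumr; apply: eq_big => [t|t _]; last by rewrite big_cons.
  rewrite theadE eqxx andbT -/(adm m (im :: t)) adm_cons//.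
  have -> : behead_tuple (cons_tuple im t) = t by exact/val_inj.
  by rewrite eqxx andbT.
apply: eq_bigl => t; rewrite -val_eqE/= cons_thead.
have [tm|tm] := eqVneq (val (thead t)) m.
  rewrite andbF; apply/esym/negbTE; rewrite /adm /= tm ltnn.
  by rewrite andbF.
by rewrite andbT adm_consS.
Qed.

Let tail_sum0 m : tail_sum m 0 = 1.
Proof.
rewrite /tail_sum (big_pred1 [tuple]); first by rewrite big_nil.
by move=> t; rewrite tuple0; apply/esym/eqP.
Qed.

Let tail_sumE d m k : (m + d = s)%N -> tail_sum m k = chom (drop m nodes) k.
Proof.
have sn : size nodes = s by rewrite size_map size_enum_ord.
elim: d m k => [|d IH] m k md.
  rewrite addn0 in md; rewrite drop_oversize ?sn ?md//=.
  case: k => [|k]; first exact: tail_sum0.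
  rewrite /tail_sum big_pred0// => t; apply/negbTE.
  have -> : tval t = thead t :: behead t by rewrite {1}(tuple_eta t).
  by rewrite /adm /= [(s <= _)%N]leqNgt ltn_ord andbF.
have ms : (m < s)%N by rewrite -md addnS ltnS leq_addr.
have -> : drop m nodes = zeta (Ordinal ms) :: drop m.+1 nodes.
  rewrite (drop_nth 0) ?sn//; congr (_ :: _).
  rewrite (nth_map (Ordinal ms)) ?size_enum_ord//; congr zeta.
  by apply/val_inj; rewrite /= nth_enum_ord.
elim: k => [|k IHk]; first by rewrite tail_sum0 chom0.
by rewrite tail_sum_rec chomS IHk IH// addSnnS.
Qed.

Lemma hsym_chom k : hsym zeta k = chom nodes k.
Proof.
rewrite -[nodes]drop0 -(@tail_sumE s)// /hsym /tail_sum.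
apply: eq_bigl => t; rewrite /adm (_ : all _ _ = true) ?andbT//.
exact/allP.
Qed.

Hypothesis zeta_circle : forall k, circle (zeta k).
Hypothesis zeta_inj : injective zeta.

(** In degrees at least [s] the polynomial [p] has no coefficient, so [a (k + s)] is the lagged
    combination of the coefficients of [g]. The inversion is then applied to [g] shifted by [j - s],
    whose value at 0 is the desired limit. *)
Lemma hsym_tail_cvg (f G : R[i] -> R[i]) (g a : nat -> R[i]) (p : {poly R[i]}) (j :
  nat) : taylor_on_disk f a ->
  taylor_on_disk G g -> H2_seq g -> (size p <= s)%N ->
  (forall z, disk z -> f z = p.[z] + (\prod_(k < s) ('X - (zeta k)%:P)).[z] * G z) ->
  (s <= j)%N -> hsym_tail zeta a j @ \oo --> g (j - s)%N.
Proof.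
move=> fa Gg hg sp fp sj.
have sn : size nodes = s by rewrite size_map size_enum_ord.
have un : uniq nodes by rewrite map_inj_uniq// enum_uniq.
have n1 x : x \in nodes -> normc x = 1 by move=> /mapP[k _ ->]; exact: zeta_circle.
have aE k : a (k + s)%N = lag_coefs nodes g k.
  have h0 := taylor_add (taylor_poly p) (taylor_nodal (l := nodes) Gg).
  have fE : {in disk, (fun z => p.[z] + (nodal nodes).[z] * G z) =1 f}.
    by move=> z; rewrite inE => dz; rewrite fp// /nodal big_map big_enum.
  have h : taylor_on_disk f _ := taylor_ext fE h0.
  have -> := taylor_unique fa h.
  by rewrite -{2}sn nodal_coefsE nth_default ?add0r// (leq_trans sp)// leq_addl.
pose g' k := g (k + (j - s))%N.
have g0 : g' @ \oo --> (0 : R[i]).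
  have hg2 := sum_bounded_shift (j - s) (fun i => sqr_ge0 (normc (g i))) hg.
  have h2 := sum_bounded_cvg0 (fun i => sqr_ge0 _) hg2.
  apply/cvg_normc; apply/cvgrPdist_lt => e e0.
  have e2 : 0 < e ^+ 2 by rewrite exprn_gt0.
  move/cvgrPdist_lt: h2 => /(_ _ e2); apply: filterS => i.
  rewrite !sub0r !normrN ger0_norm ?sqr_ge0// subr0 ger0_norm ?normc_ge0//.
  by rewrite ltr_pXn2r// nnegrE ?normc_ge0// ltW.
have := chom_abel_sum un n1 g0.
(* The [M + 1] terms starting at degree [j] end before [M + j + 1]. *)
have -> : (fun M => \sum_(0 <= k < M.+1) lag_coefs nodes g' k * chom nodes k) =
    (fun M => hsym_tail zeta a j (M + j.+1)%N).
  have shift_sum (F : nat -> R[i]) M :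
      \sum_(j <= k < M + j) F k = \sum_(0 <= k < M) F (k + j)%N.
    by rewrite -{1}(add0n j) big_addn addnK.
  apply/funext => M; rewrite /hsym_tail addnS -addSn shift_sum.
  apply: eq_bigr => k _; rewrite addnK hsym_chom /g' lag_coefs_shift.
  by rewrite -{2}(subnK sj) addnA aE.
by rewrite (cvg_shiftn j.+1 (hsym_tail zeta a j)) /g' add0n.
Qed.
End hsym_chom.

Unset Implicit Arguments.

Theorem theorem2p3 (R : realType) (s : nat) (s_ge1 : (1 <= s)%N)
  (zeta : 'I_s -> R[i]) (zeta_circle : forall k, circle (zeta k))
  (zeta_inj : injective zeta) (c : 'I_s -> {posnum R})
  (f : R[i] -> R[i]) (fhat : nat -> R[i]) (f_series : taylor_on_disk f fhat)
  (fD : Dspace (atomic_measure zeta c) f) (n : nat) (n_ge_s : (s <= n)%N) :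
  let outer : nat -> R :=
    fun N => \sum_(n.+1 <= j < N) normc (limn (hsym_tail zeta fhat j)) ^+ 2 in
  [/\ forall j, (n.+1 <= j)%N -> cvgn (hsym_tail zeta fhat j),
      cvgn outer
    & dist_poly zeta f n = Num.sqrt (limn outer)].
Proof.
move=> outer.
have [g [/H2P[a ga ha] [p sp fp]]] :=
  atomic_Dspace_representation zeta_circle zeta_inj s_ge1 f_series fD.
(* Since [n >= s], every [j > n] lies in the range of degrees that [p] does not reach. *)
have tailP j : (n.+1 <= j)%N -> hsym_tail zeta fhat j @ \oo --> a (j - s)%N.
  move=> nj; apply: (hsym_tail_cvg zeta_circle zeta_inj f_series ga ha sp fp).
  exact: leq_trans n_ge_s (ltnW nj).
have outerE : outer = (fun N => \sum_(n.+1 <= j < N) normc (a (j - s)%N) ^+ 2).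
  apply/funext => N; rewrite /outer !big_nat; apply: eq_bigr => j /andP[nj _].
  by rewrite (cvgc_lim (tailP j nj)).
have [couter distE] := dist_poly_is_Q zeta_circle zeta_inj n_ge_s sp ga ha fp.
split; [move=> j nj|by rewrite outerE|by rewrite outerE].
by rewrite (cvgc_lim (tailP j nj)); exact: tailP.
Qed.
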